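(* Let $\alpha$ be an action of a finite group $G$ on a simple unital $C^*$-algebra $A$, and suppose that $\alpha$ has the Rokhlin property. If $A$ has the LP property, then the fixed point algebra $A^\alpha$ and the crossed product $A\rtimes_\alpha G$ have the LP property.
   Context: LP property: a $C^*$-algebra has the LP property if the linear span of its projections is norm dense in it. $A^\infty=\ell^\infty(\mathbb N,A)/c_0(A)$, where $c_0(A)=\{(a_n)\in\ell^\infty(\mathbb N,A):\lim_n\|a_n\|=0\}$; $A$ is identified with the classes of constant sequences in $A^\infty$, and $A_\infty=A^\infty\cap A'$. For $\beta\in\mathrm{Aut}(A)$, $\beta_\infty$ is the automorphism of $A_\infty$ induced by $\beta$ (applied termwise). Rokhlin property (in the sense of Izumi): an action $\alpha$ of a finite group $G$ on a unital $C^*$-algebra $A$ has the Rokhlin property if there is a partition of unity $\{e_g\}_{g\in G}\subset A_\infty$ consisting of projections such that $(\alpha_g)_\infty(e_h)=e_{gh}$ for all $g,h\in G$. $A^\alpha=\{a\in A:\alpha_g(a)=a\text{ for all }g\in G\}$. *)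

(* Defs.v *)
From HB Require Import structures.
From mathcomp Require Import all_boot all_order all_algebra all_fingroup.
From mathcomp Require Import generic_quotient ring_quotient complex.
From mathcomp Require Import all_classical all_reals all_analysis ring lra.

Set Implicit Arguments.
Unset Strict Implicit.
Unset Printing Implicit Defensive.

Import Order.TTheory GRing.Theory Num.Theory.
Import numFieldNormedType.Exports ComplexField.Normc.

Local Open Scope classical_set_scope.
Local Open Scope ring_scope.

HB.mixin Record hasStar (R : realType) A of GRing.Algebra R[i] A := {
  star : A -> A;
  starK : involutive star;
  starD : {morph star : x y / x + y};
  starM : forall x y, star (x * y) = star y * star x;
  starZ : forall (c : R[i]) x, star (c *: x) = c^* *: star x
}.

#[short(type="starAlgType")]
HB.structure Definition StarAlgebra (R : realType) :=
  {A of GRing.Algebra R[i] A & hasStar R A}.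

(* The norm is a bare function here; its axioms are in isCStar. It is not taken
   from completeNormedModType, since Hierarchy Builder rejects a structure that
   joins rings and normed modules without lying below numDomainType. *)
HB.mixin Record hasCNorm (R : realType) A of StarAlgebra R A := {
  cnorm : A -> R
}.

#[short(type="preCStarType")]
HB.structure Definition PreCStarAlgebra (R : realType) :=
  {A of StarAlgebra R A & hasCNorm R A}.

HB.mixin Record isCStar (R : realType) A of PreCStarAlgebra R A := {
  cnormD : forall x y : A, cnorm (x + y) <= cnorm x + cnorm y;
  cnormZ : forall (c : R[i]) (x : A), cnorm (c *: x) = normc c * cnorm x;
  cnorm0_eq0 : forall x : A, cnorm x = 0 -> x = 0;
  cnormM : forall x y : A, cnorm (x * y) <= cnorm x * cnorm y;
  cnorm_starM : forall x : A, cnorm (star x * x) = cnorm x ^+ 2;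
  cnorm_complete : forall u : nat -> A,
    (forall eps : R, 0 < eps -> exists N : nat, forall m n : nat,
      (N <= m)%N -> (N <= n)%N -> cnorm (u m - u n) < eps) ->
    exists l : A, (fun n => cnorm (u n - l)) @ \oo --> (0 : R)
}.

(* Unital and nonzero, as every algType is. *)
#[short(type="cstarType")]
HB.structure Definition CStarAlgebra (R : realType) :=
  {A of PreCStarAlgebra R A & isCStar R A}.

Section StarTheory.
Variables (R : realType) (A : starAlgType R).
Implicit Types x y : A.

Lemma star0 : star (0 : A) = 0.
Proof. by apply: (addrI (star 0)); rewrite -starD !addr0. Qed.

Lemma star1 : star (1 : A) = 1.
Proof. by rewrite -[LHS]mulr1 -{2}(starK 1) -starM mulr1 starK. Qed.

Lemma starN : {morph (@star R A) : x / - x}.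
Proof.
by move=> x; apply: (addrI (star x)); rewrite -starD !subrr star0.
Qed.

Lemma star_sum (I : Type) (r : seq I) (P : pred I) (F : I -> A) :
  star (\sum_(i <- r | P i) F i) = \sum_(i <- r | P i) star (F i).
Proof. exact: (big_morph _ (@starD R A) star0). Qed.

Definition is_projection (p : A) : Prop := p * p = p /\ star p = p.

Definition is_unitary (u : A) : Prop := star u * u = 1 /\ u * star u = 1.

Definition projection_span : set A :=
  [set x | exists (n : nat) (c : 'I_n -> R[i]) (p : 'I_n -> A),
     (forall i, is_projection (p i)) /\ x = \sum_i c i *: p i].

End StarTheory.

Definition LP_property (R : realType) (A : preCStarType R) : Prop :=
  forall (a : A) (eps : R), 0 < eps ->
    exists2 x, projection_span x & cnorm (a - x) < eps.

Definition star_preserving (R : realType) (A B : starAlgType R) (f : A -> B) :=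
  {morph f : x / star x >-> star x}.

Section CStarTheory.
Variables (R : realType).
Implicit Types A B : cstarType R.

Lemma cnorm0 A : cnorm (0 : A) = 0.
Proof. by rewrite -(scale0r (0 : A)) cnormZ normc0 mul0r. Qed.

Lemma cnormN A (x : A) : cnorm (- x) = cnorm x.
Proof.
by rewrite -scaleN1r cnormZ normcN normc1 mul1r.
Qed.

Lemma cnorm_ge0 A (x : A) : 0 <= cnorm x.
Proof.
have := cnormD x (- x); rewrite subrr cnorm0 cnormN -mulr2n.
by rewrite pmulrn_lge0.
Qed.

Lemma cnorm_gt0 A (x : A) : x != 0 -> 0 < cnorm x.
Proof.
move=> x0; rewrite lt0r cnorm_ge0 andbT.
by apply: contra_neq x0 => /cnorm0_eq0.
Qed.

Lemma cnorm1 A : cnorm (1 : A) = 1.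
Proof.
have h := cnorm_starM (1 : A); rewrite star1 mul1r in h.
have n0 := lt0r_neq0 (cnorm_gt0 (oner_neq0 A)).
by apply: (mulfI n0); rewrite mulr1 -expr2.
Qed.

Lemma cnorm_star A (x : A) : cnorm (star x) = cnorm x.
Proof.
have le1 (y : A) : cnorm y <= cnorm (star y).
  have [->|y0] := eqVneq y 0; first by rewrite star0.
  have := cnormM (star y) y.
  by rewrite cnorm_starM expr2 ler_pM2r // cnorm_gt0.
by apply/eqP; rewrite eq_le le1 -{2}(starK x) le1.
Qed.

Lemma cnormB A (x y : A) : cnorm (x - y) <= cnorm x + cnorm y.
Proof. by rewrite -(cnormN y) cnormD. Qed.

Lemma cnorm_distC A (x y : A) : cnorm (x - y) = cnorm (y - x).
Proof. by rewrite -cnormN opprB. Qed.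

Lemma cnorm_sum A (I : Type) (r : seq I) (P : pred I) (F : I -> A) :
  cnorm (\sum_(i <- r | P i) F i) <= \sum_(i <- r | P i) cnorm (F i).
Proof.
elim/big_rec2: _ => [|i y1 y2 _ le12]; first by rewrite cnorm0.
by rewrite (le_trans (cnormD _ _))// lerD2l.
Qed.

(* 1 - z is a square root of 1 - w for z the fixed point of the contraction
   z |-> (w + z ^+ 2) / 2. *)
Section SquareRoot.
Variables (A : cstarType R) (w : A).
Hypothesis w1 : cnorm w < 1.

Let h : R[i] := (2^-1 : R)%:C%C.
Let zs (n : nat) : A := iter n (fun z => h *: (w + z ^+ 2)) 0.
Let r := cnorm w.

Let zsS n : zs n.+1 = h *: (w + zs n ^+ 2). Proof. by []. Qed.

Let r_ge0 : 0 <= r. Proof. exact: cnorm_ge0. Qed.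

Let nh : normc h = 2^-1.
Proof. by rewrite /h /= expr0n addr0 sqrtr_sqr ger0_norm. Qed.

Let zs_le n : cnorm (zs n) <= r.
Proof.
elim: n => [|n IH]; first by rewrite /= cnorm0.
rewrite zsS cnormZ nh.
rewrite mulrC ler_pdivrMr// (le_trans (cnormD _ _))// mulr_natr mulr2n lerD2l.
rewrite expr2 (le_trans (cnormM _ _))//.
rewrite (le_trans (ler_pM _ _ IH IH)) ?cnorm_ge0//.
by rewrite -[leRHS]mulr1 ler_wpM2l// ltW.
Qed.

Let zs_step n : cnorm (zs n.+1 - zs n) <= r ^+ n.+1.
Proof.
elim: n => [|n IH].
  rewrite zsS subr0 expr0n/= addr0 cnormZ nh expr1 mulrC ler_pdivrMr//.
  by rewrite mulr_natr mulr2n lerDl.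
rewrite [zs n.+2]zsS {2}[zs n.+1]zsS -scalerBr opprD addrACA subrr add0r cnormZ nh mulrC ler_pdivrMr//.
have -> : zs n.+1 ^+ 2 - zs n ^+ 2 =
    zs n.+1 * (zs n.+1 - zs n) + (zs n.+1 - zs n) * zs n.
  by rewrite mulrBr mulrBl !expr2 addrA subrK.
rewrite (le_trans (cnormD _ _))// mulr_natr mulr2n lerD//.
  by rewrite (le_trans (cnormM _ _))// exprS ler_pM ?cnorm_ge0.
by rewrite (le_trans (cnormM _ _))// exprSr ler_pM ?cnorm_ge0.
Qed.

Let zs_dist n m : (1 - r) * cnorm (zs (n + m) - zs n) <= r ^+ n.+1.
Proof.
have r1 : 0 <= 1 - r by rewrite subr_ge0 ltW.
elim: m n => [|m IH] n.
  by rewrite addn0 subrr cnorm0 mulr0 exprn_ge0.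
have -> : zs (n + m.+1) - zs n = (zs (n.+1 + m) - zs n.+1) + (zs n.+1 - zs n).
  by rewrite addrA subrK addSnnS.
rewrite (le_trans (ler_wpM2l r1 (cnormD _ _)))// mulrDr.
rewrite (le_trans (lerD (IH n.+1) (ler_wpM2l r1 (zs_step n))))//.
by rewrite [r ^+ n.+2]exprS mulrBl mul1r addrC subrK.
Qed.

Let zs_cauchy (eps : R) : 0 < eps -> exists N : nat, forall m n : nat,
  (N <= m)%N -> (N <= n)%N -> cnorm (zs m - zs n) < eps.
Proof.
move=> e0.
have r1 : 0 < 1 - r by rewrite subr_gt0.
have rlt : `|r| < 1 by rewrite ger0_norm.
have := cvg_expr rlt => /cvgr0Pnorm_lt /(_ ((1 - r) * eps / 2)).
have d0 : 0 < (1 - r) * eps / 2 by rewrite !mulr_gt0 ?invr_gt0.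
move=> /(_ d0) [N _ HN]; exists N.
have main n : (N <= n)%N -> cnorm (zs n - zs N) < eps / 2.
  move=> Nn; rewrite -(ltr_pM2l r1) mulrA.
  rewrite -{1}(subnKC Nn) (le_lt_trans (zs_dist _ _))//.
  have := HN N.+1 (leqnSn N); rewrite /= ger0_norm//.
  exact: exprn_ge0.
move=> m n Nm Nn.
have -> : zs m - zs n = (zs m - zs N) + (zs N - zs n) by rewrite addrA subrK.
rewrite (le_lt_trans (cnormD _ _))// [ltRHS]splitr ltrD ?main//.
by rewrite cnorm_distC main.
Qed.

Let zs_limP (z : A) (e : R) : (fun n => cnorm (zs n - z)) @ \oo --> (0 : R) ->
  0 < e -> exists N, forall n, (N <= n)%N -> cnorm (zs n - z) < e.
Proof.
move=> /cvgr0Pnorm_lt H e0; have [N _ HN] := H _ e0.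
by exists N => n /HN; rewrite /= ger0_norm ?cnorm_ge0.
Qed.

Let closed_eq (z : A) (F : A -> A) (K : R) : 0 < K ->
  (fun n => cnorm (zs n - z)) @ \oo --> (0 : R) ->
  (forall n, cnorm (F z) <= K * (cnorm (zs n - z) + cnorm (zs n.+1 - z))) ->
  F z = 0.
Proof.
move=> K0 zl H; apply: cnorm0_eq0; apply/eqP; rewrite eq_le cnorm_ge0 andbT.
apply/ler_addgt0Pl => e e0; rewrite addr0.
have d0 : 0 < e / K / 2 by rewrite !mulr_gt0 ?invr_gt0.
have [N HN] := zs_limP zl d0.
rewrite (le_trans (H N))// -ler_pdivlMl// mulrC.
by rewrite [leRHS]splitr lerD// ltW// HN.
Qed.

Lemma sqrt_one_sub : star w = w -> exists y : A,
  [/\ star y = y, y ^+ 2 = 1 - w & forall x, x * w = w * x -> x * y = y * x].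
Proof.
move=> sw; have [z zl] := cnorm_complete zs zs_cauchy.
have z1 : cnorm z <= 1 + r.
  have [N HN] := zs_limP zl (ltr01); have := HN N (leqnn _) => /ltW zN.
  have -> : z = (z - zs N) + zs N by rewrite subrK.
  by rewrite (le_trans (cnormD _ _))// lerD// cnorm_distC.
have zE : z = h *: (w + z ^+ 2).
  apply/eqP; rewrite -subr_eq0; apply/eqP.
  apply: (@closed_eq z (fun z => z - h *: (w + z ^+ 2)) (2 + r + r)) => //.
    by rewrite -addrA ltr_wpDr// addr_ge0.
  move=> n.
  have -> : z - h *: (w + z ^+ 2) =
      (z - zs n.+1) + h *: (zs n * (zs n - z) + (zs n - z) * z).
    have -> : zs n * (zs n - z) + (zs n - z) * z = zs n ^+ 2 - z ^+ 2.
      by rewrite mulrBr mulrBl !expr2 addrA subrK.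
    rewrite [zs n.+1]zsS -addrA; congr (_ + _).
    rewrite -!scalerN -scalerDr; congr (_ *: _).
    by rewrite !opprD addrA subrK.
  rewrite (le_trans (cnormD _ _))// [cnorm (z - zs n.+1)]cnorm_distC cnormZ nh [leRHS]mulrDr [leRHS]addrC.
  have r0 : 0 <= r := r_ge0.
  rewrite lerD//.
    rewrite -{1}[cnorm _]mul1r ler_wpM2r ?cnorm_ge0//; lra.
  rewrite mulrC ler_pdivrMr// (le_trans (cnormD _ _))//.
  rewrite (le_trans (lerD (cnormM _ _) (cnormM _ _)))//.
  rewrite [X in _ + X]mulrC -mulrDl mulrAC ler_wpM2r ?cnorm_ge0//.
  rewrite (le_trans (lerD (zs_le n) z1))//; lra.
have sz : star z = z.
  have szs n : star (zs n) = zs n.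
    elim: n => [|n IH]; first exact: star0.
    rewrite zsS starZ starD sw expr2 starM IH.
    congr (_ *: _); apply/eqP; rewrite eq_complex /= ?oppr0 ?eqxx//.
  apply/eqP; rewrite -subr_eq0; apply/eqP.
  apply: (@closed_eq z (fun z => star z - z) 2) => // n.
  have -> : star z - z = star (z - zs n) + (zs n - z).
    by rewrite starD starN szs addrA subrK.
  rewrite (le_trans (cnormD _ _))// cnorm_star.
  rewrite [cnorm (z - _)]cnorm_distC.
  have := cnorm_ge0 (zs n.+1 - z); lra.
exists (1 - z); split.
- by rewrite starD starN star1 sz.
- have h2 : h + h = 1.
    apply/eqP; rewrite eq_complex /= !addr0 eqxx andbT.
    by apply/eqP; rewrite [RHS]splitr mul1r.
  have z2 : z + z = w + z ^+ 2.
    by rewrite {1 2}zE -scalerDl h2 scale1r.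
  rewrite expr2 mulrBl mul1r mulrBr mulr1 -expr2 opprD opprK addrA.
  rewrite -[1 - z - z]addrA -opprD z2 opprD addrA.
  by rewrite subrK.
move=> x xw.
have xzs n : x * zs n = zs n * x.
  elim: n => [|n IH]; first by rewrite mulr0 mul0r.
  rewrite zsS -scalerAr -scalerAl mulrDr mulrDl xw.
  by rewrite expr2 mulrA IH -mulrA IH mulrA.
rewrite mulrBr mulrBl mulr1 mul1r; congr (_ - _).
apply/eqP; rewrite -subr_eq0; apply/eqP.
apply: (@closed_eq z (fun z => x * z - z * x) (2 * (cnorm x + 1))) => //.
  by rewrite mulr_gt0// ltr_wpDl// cnorm_ge0.
move=> n.
have -> : x * z - z * x = (zs n - z) * x - x * (zs n - z).
  by rewrite mulrBl mulrBr xzs opprB [RHS]addrC [RHS]addrA subrK.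
rewrite (le_trans (cnormB _ _))//.
rewrite (le_trans (lerD (cnormM _ _) (cnormM _ _)))//.
have := cnorm_ge0 x; have := cnorm_ge0 (zs n - z).
have := cnorm_ge0 (zs n.+1 - z); nra.
Qed.

End SquareRoot.

Section Contractive.
Variables (A B : cstarType R) (f : {lrmorphism A -> B}).
Hypothesis f_star : star_preserving f.

Let contractive_sa (x : A) : star x = x -> cnorm x < 1 -> cnorm (f x) <= 1.
Proof.
move=> sx x1.
have w1 : cnorm (x ^+ 2) < 1.
  rewrite expr2 (le_lt_trans (cnormM _ _))//.
  by rewrite mulr_ilt1 ?cnorm_ge0.
have sw : star (x ^+ 2) = x ^+ 2 by rewrite expr2 starM sx.
have [y [sy y2 yC]] := sqrt_one_sub w1 sw.
have xy : x * y = y * x by apply: yC; rewrite -exprS -exprSr.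
pose i : R[i] := 'i%C.
have ii : i * i = -1 by rewrite -expr2 sqr_i.
have ic : i^* = - i.
  by apply/eqP; rewrite eq_complex /= oppr0 !eqxx.
pose u := x + i *: y.
have su : star u = x - i *: y by rewrite starD starZ sx sy ic scaleNr.
have uu : star u * u = 1.
  rewrite su mulrDl !mulrDr !mulNr -!scalerAl -!scalerAr scalerA ii.
  by rewrite xy scaleN1r opprK addrA addrK -!expr2 y2 addrC subrK.
have fu : cnorm (f u) = 1.
  apply/eqP; rewrite -(@eqrXn2 _ 2%N) ?cnorm_ge0//.
  by rewrite -cnorm_starM -f_star -rmorphM uu rmorph1 cnorm1 expr1n.
have : cnorm (f x *+ 2) <= 2.
  have -> : f x *+ 2 = f u + star (f u).
    by rewrite -f_star su -rmorphD addrA addrAC addrK -mulr2n rmorphMn.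
  by rewrite (le_trans (cnormD _ _))// cnorm_star fu.
rewrite -scaler_nat cnormZ.
have -> : normc (2%:R : R[i]) = 2.
  by rewrite /= addr0 expr0n addr0 sqrtr_sqr ger0_norm.
by rewrite -[leRHS]mulr1 ler_pM2l.
Qed.

Lemma cnorm_lrmorphism_le (a : A) : cnorm (f a) <= cnorm a.
Proof.
have sa (x : A) : star x = x -> cnorm (f x) <= cnorm x.
  move=> sx; apply/ler_addgt0Pl => e e0.
  have t0 : 0 < e + cnorm x by rewrite ltr_wpDr ?cnorm_ge0.
  pose c : R[i] := ((e + cnorm x)^-1)%:C%C.
  have nc : normc c = (e + cnorm x)^-1.
    by rewrite /= expr0n addr0 sqrtr_sqr ger0_norm// invr_ge0 ltW.
  have sc : star (c *: x) = c *: x.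
    by rewrite starZ sx; congr (_ *: _); apply/eqP; rewrite eq_complex /= oppr0 !eqxx.
  have := contractive_sa sc; rewrite linearZ !cnormZ nc !ler_pdivrMl// mulr1.
  by apply; rewrite ltr_pdivrMl// mulr1 ltrDr.
rewrite -(@ler_pXn2r _ 2%N) ?nnegrE ?cnorm_ge0//.
rewrite -!cnorm_starM -f_star -rmorphM sa//.
by rewrite starM starK.
Qed.
End Contractive.
End CStarTheory.

(* The last condition on I says that it is norm closed. A is nonzero because an
   algType is a nonzero ring. *)
Definition simple_cstar (R : realType) (A : cstarType R) : Prop :=
  forall I : set A,
    I 0 -> (forall x y, I x -> I y -> I (x + y)) ->
    (forall (c : R[i]) x, I x -> I (c *: x)) ->
    (forall a x, I x -> I (a * x) /\ I (x * a)) ->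
    (forall (u : nat -> A) (l : A), (forall n, I (u n)) ->
      (fun n => cnorm (u n - l)) @ \oo --> (0 : R) -> I l) ->
    I = [set 0] \/ I = setT.

Record cstar_action (gT : finGroupType) (R : realType) (A : cstarType R) :=
  CStarAction {
    aut :> gT -> {lrmorphism A -> A};
    aut_star : forall g, star_preserving (aut g);
    aut1 : forall x, aut 1%g x = x;
    autM : forall g h x, aut (g * h)%g x = aut g (aut h x)
  }.

Section Action.
Variables (gT : finGroupType) (R : realType) (A : cstarType R).
Variable alpha : cstar_action gT A.

Lemma autK g : cancel (alpha g) (alpha g^-1%g).
Proof. by move=> x; rewrite -autM mulVg aut1. Qed.

Lemma autVK g : cancel (alpha g^-1%g) (alpha g).
Proof. by move=> x; rewrite -autM mulgV aut1. Qed.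

Lemma cnorm_aut g x : cnorm (alpha g x) = cnorm x.
Proof.
apply/eqP; rewrite eq_le cnorm_lrmorphism_le; last exact: aut_star.
rewrite -{1}(autK g x) cnorm_lrmorphism_le//; exact: aut_star.
Qed.

Definition fixed_pred : {pred A} := fun x => [forall g, alpha g x == x].

Lemma fixedP x : reflect (forall g, alpha g x = x) (x \in fixed_pred).
Proof. by apply: (iffP forallP) => H g; apply/eqP; apply: H. Qed.

Fact fixed_subalg_closed : GRing.subsemialg_closed fixed_pred.
Proof.
apply: GRing.subalg_closed_semi; split.
- by apply/fixedP => g; rewrite rmorph1.
- move=> c x y /fixedP xf /fixedP yf; apply/fixedP => g.
  by rewrite linearP/= xf yf.
- move=> x y /fixedP xf /fixedP yf; apply/fixedP => g.
  by rewrite rmorphM/= xf yf.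
Qed.
HB.instance Definition _ :=
  GRing.isSubalgClosed.Build R[i] A fixed_pred fixed_subalg_closed.

Record fixed_algebra :=
  FixedAlgebra { fixed_val :> A; _ : fixed_val \in fixed_pred }.
HB.instance Definition _ := [isSub for fixed_val].
HB.instance Definition _ := [Choice of fixed_algebra by <:].
HB.instance Definition _ := [SubChoice_isSubAlgebra of fixed_algebra by <:].

Fact fixed_star_subproof (x : fixed_algebra) : star (val x) \in fixed_pred.
Proof.
apply/fixedP => g; rewrite aut_star; congr star.
by case: x => x /= /fixedP.
Qed.

Definition fixed_star (x : fixed_algebra) : fixed_algebra :=
  FixedAlgebra (fixed_star_subproof x).

Fact fixed_starK : involutive fixed_star.
Proof. by move=> x; apply: val_inj; rewrite /= starK. Qed.
Fact fixed_starD : {morph fixed_star : x y / x + y}.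
Proof. by move=> x y; apply: val_inj; rewrite /= starD. Qed.
Fact fixed_starM x y : fixed_star (x * y) = fixed_star y * fixed_star x.
Proof. by apply: val_inj; rewrite /= starM. Qed.
Fact fixed_starZ (c : R[i]) x : fixed_star (c *: x) = c^* *: fixed_star x.
Proof. by apply: val_inj; rewrite /= starZ. Qed.
HB.instance Definition _ := hasStar.Build R fixed_algebra
  fixed_starK fixed_starD fixed_starM fixed_starZ.
HB.instance Definition _ :=
  hasCNorm.Build R fixed_algebra (fun x => cnorm (val x)).

Fact fixed_cnormD (x y : fixed_algebra) :
  cnorm (x + y) <= cnorm x + cnorm y.
Proof. exact: cnormD. Qed.
Fact fixed_cnormZ (c : R[i]) (x : fixed_algebra) :
  cnorm (c *: x) = normc c * cnorm x.
Proof. exact: cnormZ. Qed.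
Fact fixed_cnorm0_eq0 (x : fixed_algebra) : cnorm x = 0 -> x = 0.
Proof. by move=> /cnorm0_eq0 x0; apply: val_inj. Qed.
Fact fixed_cnormM (x y : fixed_algebra) :
  cnorm (x * y) <= cnorm x * cnorm y.
Proof. exact: cnormM. Qed.
Fact fixed_cnorm_starM (x : fixed_algebra) :
  cnorm (star x * x) = cnorm x ^+ 2.
Proof. exact: cnorm_starM. Qed.
Fact fixed_complete (u : nat -> fixed_algebra) :
  (forall eps : R, 0 < eps -> exists N : nat, forall m n : nat,
      (N <= m)%N -> (N <= n)%N -> cnorm (u m - u n) < eps) ->
  exists l : fixed_algebra, (fun n => cnorm (u n - l)) @ \oo --> (0 : R).
Proof.
move=> uC; have [l ul] := cnorm_complete (fun n => val (u n)) uC.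
suff lf : l \in fixed_pred by exists (FixedAlgebra lf).
apply/fixedP => g; apply/eqP; rewrite -subr_eq0; apply/eqP/cnorm0_eq0.
apply/eqP; rewrite eq_le cnorm_ge0 andbT; apply/ler_addgt0Pl => e e0.
have e2 : 0 < e / 2 by rewrite divr_gt0.
move/cvgr0Pnorm_lt : ul => /(_ _ e2)[N _ /(_ N (leqnn N))].
rewrite /= ger0_norm ?cnorm_ge0// => uN.
have uf : alpha g (val (u N)) = val (u N) by case: (u N) => v /= /fixedP.
have -> : alpha g l - l = (val (u N) - l) - alpha g (val (u N) - l).
  by rewrite rmorphB/= uf opprB [RHS]addrC addrA subrK.
rewrite (le_trans (cnormB _ _))// cnorm_aut addr0 [leRHS]splitr.
by rewrite lerD// ltW.
Qed.
HB.instance Definition _ := isCStar.Build R fixed_algebra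
  fixed_cnormD fixed_cnormZ fixed_cnorm0_eq0 fixed_cnormM fixed_cnorm_starM
  fixed_complete.
End Action.

Section FunAlgebra.
Variables (K : pzRingType) (A : algType K).
Fact nat_fun_scalerAl (k : K) (f g : nat -> A) : k *: (f * g) = (k *: f) * g.
Proof. by apply/funext => n; exact: scalerAl. Qed.
HB.instance Definition _ :=
  GRing.Lmodule_isLalgebra.Build K (nat -> A) nat_fun_scalerAl.
Fact nat_fun_scalerAr (k : K) (f g : nat -> A) : k *: (f * g) = f * (k *: g).
Proof. by apply/funext => n; exact: scalerAr. Qed.
HB.instance Definition _ :=
  GRing.Lalgebra_isAlgebra.Build K (nat -> A) nat_fun_scalerAr.
End FunAlgebra.

Section SequenceAlgebra.
Variables (R : realType) (A : cstarType R).

Definition bounded_pred : {pred nat -> A} :=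
  fun s => `[< exists M : R, forall n, cnorm (s n) <= M >].

Lemma boundedP (s : nat -> A) :
  reflect (exists M : R, forall n, cnorm (s n) <= M) (s \in bounded_pred).
Proof. exact: asboolP. Qed.

Fact bounded_subalg_closed : GRing.subsemialg_closed bounded_pred.
Proof.
apply: GRing.subalg_closed_semi; split.
- by apply/boundedP; exists 1 => n; rewrite cnorm1.
- move=> c x y /boundedP[M xM] /boundedP[N yN]; apply/boundedP.
  exists (normc c * M + N) => n.
  rewrite (le_trans (cnormD _ _))// lerD// cnormZ ler_wpM2l//.
  by case: c => a b; exact: sqrtr_ge0.
- move=> x y /boundedP[M xM] /boundedP[N yN]; apply/boundedP.
  by exists (M * N) => n; rewrite (le_trans (cnormM _ _))// ler_pM ?cnorm_ge0.
Qed.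
HB.instance Definition _ :=
  GRing.isSubalgClosed.Build R[i] (nat -> A) bounded_pred bounded_subalg_closed.

Record linfty := Linfty { seq_of :> nat -> A; _ : seq_of \in bounded_pred }.
HB.instance Definition _ := [isSub for seq_of].
HB.instance Definition _ := [Choice of linfty by <:].
HB.instance Definition _ := [SubChoice_isSubAlgebra of linfty by <:].

Lemma linftyB (x y : linfty) n : (x - y) n = x n - y n.
Proof. by []. Qed.

Lemma linftyM (x y : linfty) n : (x * y) n = x n * y n.
Proof. by []. Qed.

Fact linfty_star_subproof (s : linfty) :
  (fun n => star (s n)) \in bounded_pred.
Proof.
case: s => s /= /boundedP[M sM]; apply/boundedP.
by exists M => n; rewrite cnorm_star.
Qed.
Definition linfty_star (s : linfty) : linfty := Linfty (linfty_star_subproof s).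
Fact linfty_starK : involutive linfty_star.
Proof. by move=> s; apply/val_inj/funext => n /=; rewrite starK. Qed.
Fact linfty_starD : {morph linfty_star : x y / x + y}.
Proof. by move=> x y; apply/val_inj/funext => n; rewrite /= starD. Qed.
Fact linfty_starM x y : linfty_star (x * y) = linfty_star y * linfty_star x.
Proof. by apply/val_inj/funext => n; rewrite /= starM. Qed.
Fact linfty_starZ (c : R[i]) x : linfty_star (c *: x) = c^* *: linfty_star x.
Proof. by apply/val_inj/funext => n; rewrite /= starZ. Qed.
HB.instance Definition _ := hasStar.Build R linfty
  linfty_starK linfty_starD linfty_starM linfty_starZ.

Fact cst_subproof (a : A) : (fun _ : nat => a) \in bounded_pred.
Proof. by apply/boundedP; exists (cnorm a). Qed.
Definition cst_seq (a : A) : linfty := Linfty (cst_subproof a).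

Definition c0_pred : {pred linfty} :=
  fun s => `[< (fun n => cnorm (s n)) @ \oo --> (0 : R) >].

Lemma c0P (s : linfty) :
  reflect ((fun n => cnorm (s n)) @ \oo --> (0 : R)) (s \in c0_pred).
Proof. exact: asboolP. Qed.

Lemma c0_dominated (s t : linfty) (K : R) :
  (forall n, cnorm (s n) <= K * cnorm (t n)) -> t \in c0_pred -> s \in c0_pred.
Proof.
move=> st /c0P tc; apply/c0P.
apply: (@squeeze_cvgr _ _ _ _ (fun=> 0) (fun n => K * cnorm (t n))).
- by near=> n; rewrite cnorm_ge0 st.
- exact: cvg_cst.
- by rewrite -[X in _ --> X](mulr0 K); apply: cvgM => //; exact: cvg_cst.
Unshelve. all: by end_near. Qed.

Fact c0_zmod_closed : GRing.zmod_closed c0_pred.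
Proof.
split=> [|x y /c0P xc /c0P yc]; apply/c0P.
  rewrite (_ : (fun n => _) = fun=> 0); first exact: cvg_cst.
  by apply/funext => n; rewrite cnorm0.
apply: (@squeeze_cvgr _ _ _ _ (fun=> 0) (fun n => cnorm (x n) + cnorm (y n))).
- by near=> n; rewrite cnorm_ge0 cnormB.
- exact: cvg_cst.
- by rewrite -[X in _ --> X](addr0 0); apply: cvgD.
Unshelve. all: by end_near. Qed.
HB.instance Definition _ :=
  GRing.isZmodClosed.Build linfty c0_pred c0_zmod_closed.

Lemma c0_mull (x y : linfty) : y \in c0_pred -> x * y \in c0_pred.
Proof.
case: x => x /[dup] /boundedP[M xM] xb; apply: (@c0_dominated _ _ M) => n.
by rewrite (le_trans (cnormM _ _))// ler_wpM2r// cnorm_ge0.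
Qed.

Lemma c0_mulr (x y : linfty) : x \in c0_pred -> x * y \in c0_pred.
Proof.
case: y => y /[dup] /boundedP[M yM] yb; apply: (@c0_dominated _ _ M) => n.
by rewrite (le_trans (cnormM _ _))// mulrC ler_wpM2r// cnorm_ge0.
Qed.

Lemma c0_scale (c : R[i]) (x : linfty) : x \in c0_pred -> c *: x \in c0_pred.
Proof. by apply: (@c0_dominated _ _ (normc c)) => n; rewrite cnormZ. Qed.

Lemma c0_star (x : linfty) : x \in c0_pred -> star x \in c0_pred.
Proof. by apply: (@c0_dominated _ _ 1) => n; rewrite mul1r /= cnorm_star. Qed.

Lemma c0_one : 1 \notin c0_pred.
Proof.
apply/negP => /c0P; rewrite (_ : (fun n => _) = fun=> 1).
  move=> /(cvg_lim (@Rhausdorff R)); rewrite (cvg_lim (@Rhausdorff R) (@cvg_cst _ _ _ _ _)).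
  by move/eqP; rewrite oner_eq0.
by apply/funext => n; rewrite cnorm1.
Qed.

Definition Ainfty := Quotient.quot c0_pred.
HB.instance Definition _ := GRing.Zmodule.on Ainfty.
HB.instance Definition _ := EqQuotient.on Ainfty.

Definition cls (s : linfty) : Ainfty := (\pi_(Ainfty) s)%qT.

Lemma cls_eq s t : cls s = cls t <-> s - t \in c0_pred.
Proof.
split=> [/eqP|st]; first by rewrite -Quotient.idealrBE.
by apply/eqP; rewrite -Quotient.idealrBE.
Qed.
End SequenceAlgebra.

Section SequenceQuotient.
Variables (R : realType) (A : cstarType R).
Local Notation Ainf := (Ainfty A).
Local Notation c0 := (@c0_pred R A).
Implicit Types (s t : linfty A) (x y z : Ainf).

Lemma repr_cls s : repr (cls s) - s \in c0.
Proof. by apply/cls_eq; rewrite /cls reprK. Qed.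

Lemma clsP x : exists s, x = cls s.
Proof. by exists (repr x); rewrite /cls reprK. Qed.

Lemma clsD s t : cls (s + t) = cls s + cls t.
Proof. by rewrite /cls Quotient.pi_add. Qed.

Definition inf_one : Ainf := cls 1.
Definition inf_mul x y : Ainf := cls (repr x * repr y).
Definition inf_scale (c : R[i]) x : Ainf := cls (c *: repr x).
Definition inf_star x : Ainf := cls (star (repr x)).

Lemma inf_mul_cls s t : inf_mul (cls s) (cls t) = cls (s * t).
Proof.
apply/cls_eq; have -> : repr (cls s) * repr (cls t) - s * t =
    repr (cls s) * (repr (cls t) - t) + (repr (cls s) - s) * t.
  by rewrite mulrBr mulrBl addrA subrK.
by apply: rpredD; [apply: c0_mull|apply: c0_mulr]; exact: repr_cls.
Qed.

Lemma inf_scale_cls c s : inf_scale c (cls s) = cls (c *: s).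
Proof. by apply/cls_eq; rewrite -scalerBr; apply: c0_scale; exact: repr_cls. Qed.

Lemma inf_star_cls s : inf_star (cls s) = cls (star s).
Proof. by apply/cls_eq; rewrite -starN -starD; apply: c0_star; exact: repr_cls. Qed.

Fact inf_mulA : associative inf_mul.
Proof.
move=> x y z; have [s ->] := clsP x; have [t ->] := clsP y.
by have [u ->] := clsP z; rewrite !inf_mul_cls mulrA.
Qed.
Fact inf_mul1 : left_id inf_one inf_mul.
Proof. by move=> x; have [s ->] := clsP x; rewrite inf_mul_cls mul1r. Qed.
Fact inf_mulr1 : right_id inf_one inf_mul.
Proof. by move=> x; have [s ->] := clsP x; rewrite inf_mul_cls mulr1. Qed.
Fact inf_mulDl : left_distributive inf_mul +%R.
Proof.
move=> x y z; have [s ->] := clsP x; have [t ->] := clsP y.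
by have [u ->] := clsP z; rewrite -clsD !inf_mul_cls mulrDl clsD.
Qed.
Fact inf_mulDr : right_distributive inf_mul +%R.
Proof.
move=> x y z; have [s ->] := clsP x; have [t ->] := clsP y.
by have [u ->] := clsP z; rewrite -clsD !inf_mul_cls mulrDr clsD.
Qed.
Fact inf_one_neq0 : inf_one != 0.
Proof.
apply/eqP => h; have : cls 1 = cls (0 : linfty A).
  by rewrite -[LHS]/inf_one h; apply: (addrI (cls 0)); rewrite -clsD !addr0.
by move/cls_eq; rewrite subr0; apply/negP; exact: c0_one.
Qed.
HB.instance Definition _ := GRing.Zmodule_isNzRing.Build Ainf
  inf_mulA inf_mul1 inf_mulr1 inf_mulDl inf_mulDr inf_one_neq0.

Fact inf_scaleA (a b : R[i]) x :
  inf_scale a (inf_scale b x) = inf_scale (a * b) x.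
Proof. by have [s ->] := clsP x; rewrite !inf_scale_cls scalerA. Qed.
Fact inf_scale1 : left_id 1 inf_scale.
Proof. by move=> x; have [s ->] := clsP x; rewrite inf_scale_cls scale1r. Qed.
Fact inf_scaleDr : right_distributive inf_scale +%R.
Proof.
move=> c x y; have [s ->] := clsP x; have [t ->] := clsP y.
by rewrite -clsD !inf_scale_cls scalerDr clsD.
Qed.
Fact inf_scaleDl x : {morph inf_scale^~ x : a b / a + b}.
Proof.
by move=> a b; have [s ->] := clsP x; rewrite !inf_scale_cls scalerDl clsD.
Qed.
HB.instance Definition _ := GRing.Zmodule_isLmodule.Build R[i] Ainf
  inf_scaleA inf_scale1 inf_scaleDr inf_scaleDl.

Lemma clsM s t : cls (s * t) = cls s * cls t.
Proof. by rewrite -inf_mul_cls. Qed.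

Lemma clsZ c s : cls (c *: s) = c *: cls s.
Proof. by rewrite -inf_scale_cls. Qed.

Fact inf_scalerAl (c : R[i]) x y : c *: (x * y) = (c *: x) * y.
Proof.
have [s ->] := clsP x; have [t ->] := clsP y.
by rewrite -clsM -!clsZ -clsM scalerAl.
Qed.
HB.instance Definition _ :=
  GRing.Lmodule_isLalgebra.Build R[i] Ainf inf_scalerAl.
Fact inf_scalerAr (c : R[i]) x y : c *: (x * y) = x * (c *: y).
Proof.
have [s ->] := clsP x; have [t ->] := clsP y.
by rewrite -clsM -!clsZ -clsM scalerAr.
Qed.
HB.instance Definition _ :=
  GRing.Lalgebra_isAlgebra.Build R[i] Ainf inf_scalerAr.

Fact inf_starK : involutive inf_star.
Proof. by move=> x; have [s ->] := clsP x; rewrite !inf_star_cls starK. Qed.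
Fact inf_starD : {morph inf_star : x y / x + y}.
Proof.
move=> x y; have [s ->] := clsP x; have [t ->] := clsP y.
by rewrite -clsD !inf_star_cls starD clsD.
Qed.
Fact inf_starM x y : inf_star (x * y) = inf_star y * inf_star x.
Proof.
have [s ->] := clsP x; have [t ->] := clsP y.
by rewrite -clsM !inf_star_cls starM clsM.
Qed.
Fact inf_starZ (c : R[i]) x : inf_star (c *: x) = c^* *: inf_star x.
Proof.
by have [s ->] := clsP x; rewrite -clsZ !inf_star_cls starZ clsZ.
Qed.
HB.instance Definition _ := hasStar.Build R Ainf
  inf_starK inf_starD inf_starM inf_starZ.

Lemma cls_star s : star (cls s) = cls (star s).
Proof. exact: inf_star_cls. Qed.

Definition cst_cls (a : A) : Ainf := cls (cst_seq a).

(* The algebra written A_oo, the commutant of the constant sequences; Ainfty is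
   the algebra written A^oo. *)
Definition central_sequences : set Ainf :=
  [set x | forall a : A, x * cst_cls a = cst_cls a * x].

End SequenceQuotient.

Section Rokhlin.
Variables (gT : finGroupType) (R : realType) (A : cstarType R).
Variable alpha : cstar_action gT A.

Fact aut_seq_subproof g (s : linfty A) :
  (fun n => alpha g (s n)) \in @bounded_pred R A.
Proof.
case: s => s /= /boundedP[M sM]; apply/boundedP.
by exists M => n; rewrite cnorm_aut.
Qed.

Definition aut_seq g (s : linfty A) : linfty A :=
  Linfty (aut_seq_subproof g s).

(* Independent of the representative by aut_infty_cls. *)
Definition aut_infty g (x : Ainfty A) : Ainfty A := cls (aut_seq g (repr x)).

Lemma aut_infty_cls g s : aut_infty g (cls s) = cls (aut_seq g s).
Proof.
apply/cls_eq; apply: (@c0_dominated _ _ _ (repr (cls s) - s) 1).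
  by move=> n; rewrite mul1r !linftyB /= -rmorphB cnorm_aut.
exact: repr_cls.
Qed.

Lemma aut_infty_central g x :
  central_sequences x -> central_sequences (aut_infty g x).
Proof.
have [s ->] := clsP x => sC a; rewrite aut_infty_cls.
have := congr1 (aut_infty g) (sC (alpha g^-1%g a)).
rewrite /cst_cls -!clsM !aut_infty_cls.
have E (u v : linfty A) : aut_seq g (u * v) = aut_seq g u * aut_seq g v.
  by apply/val_inj/funext => n; rewrite /= rmorphM.
have C : aut_seq g (cst_seq (alpha g^-1%g a)) = cst_seq a.
  by apply/val_inj/funext => n; rewrite /= autVK.
by rewrite !E C.
Qed.

(* Projections in a C*-algebra that sum to 1 are automatically orthogonal. *)
Definition Rokhlin_property : Prop :=
  exists e : gT -> Ainfty A,
    [/\ forall g, central_sequences (e g),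
        forall g, is_projection (e g),
        \sum_g e g = 1
      & forall g h, aut_infty g (e h) = e (g * h)%g].

End Rokhlin.

Section CrossedProduct.
Variables (gT : finGroupType) (R : realType) (A : cstarType R).

(* f stands for \sum_g f(g) u_g, and the operations are those forced by
   u_g u_h = u_(gh), u_g^* = u_(g^-1) and u_g a u_g^* = alpha_g(a). *)
Definition crossed_product (alpha : cstar_action gT A) : Type :=
  {ffun gT -> A}.

Variable alpha : cstar_action gT A.
Local Notation B := (crossed_product alpha).
HB.instance Definition _ := GRing.Lmodule.copy B {ffun gT -> A}.
Implicit Types f h : B.

Definition crossed_one : B := [ffun k => (k == 1%g)%:R].
Definition crossed_mul f h : B :=
  [ffun k => \sum_g f g * alpha g (h (g^-1 * k)%g)].
Definition crossed_star f : B := [ffun g => alpha g (star (f g^-1%g))].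

Fact crossed_mulA : associative crossed_mul.
Proof.
move=> f1 f2 f3; apply/ffunP => k; rewrite !ffunE.
under eq_bigr do rewrite ffunE rmorph_sum mulr_sumr.
under [RHS]eq_bigr do rewrite ffunE mulr_suml.
rewrite [RHS]exchange_big /=; apply: eq_bigr => g _.
rewrite [RHS](reindex_inj (mulgI g)) /=; apply: eq_bigr => l _.
by rewrite rmorphM /= mulrA -autM invMg mulgA mulKg.
Qed.
Fact crossed_mul1 : left_id crossed_one crossed_mul.
Proof.
move=> f; apply/ffunP => k; rewrite ffunE (bigD1 1%g) //= big1 => [|g g1].
  by rewrite ffunE eqxx mul1r aut1 invg1 mul1g addr0.
by rewrite ffunE (negbTE g1) mul0r.
Qed.
Fact crossed_mulr1 : right_id crossed_one crossed_mul.
Proof.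
move=> f; apply/ffunP => k; rewrite ffunE (bigD1 k) //= big1 => [|g gk].
  by rewrite ffunE mulVg eqxx rmorph1 mulr1 addr0.
rewrite ffunE -eq_mulVg1 (negbTE gk) rmorph0 mulr0 //.
Qed.
Fact crossed_mulDl : left_distributive crossed_mul +%R.
Proof.
move=> f1 f2 f3; apply/ffunP => k; rewrite !ffunE -big_split /=.
by apply: eq_bigr => g _; rewrite ffunE mulrDl.
Qed.
Fact crossed_mulDr : right_distributive crossed_mul +%R.
Proof.
move=> f1 f2 f3; apply/ffunP => k; rewrite !ffunE -big_split /=.
by apply: eq_bigr => g _; rewrite ffunE rmorphD mulrDr.
Qed.
Fact crossed_one_neq0 : crossed_one != 0.
Proof.
apply/eqP => /ffunP /(_ 1%g); rewrite !ffunE eqxx => /eqP.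
by rewrite oner_eq0.
Qed.
HB.instance Definition _ := GRing.Zmodule_isNzRing.Build B
  crossed_mulA crossed_mul1 crossed_mulr1 crossed_mulDl crossed_mulDr
  crossed_one_neq0.

Fact crossed_scalerAl (c : R[i]) f h : c *: (f * h) = (c *: f) * h.
Proof.
apply/ffunP => k; rewrite !ffunE scaler_sumr; apply: eq_bigr => g _.
by rewrite ffunE scalerAl.
Qed.
HB.instance Definition _ :=
  GRing.Lmodule_isLalgebra.Build R[i] B crossed_scalerAl.
Fact crossed_scalerAr (c : R[i]) f h : c *: (f * h) = f * (c *: h).
Proof.
apply/ffunP => k; rewrite !ffunE scaler_sumr; apply: eq_bigr => g _.
by rewrite ffunE linearZ scalerAr.
Qed.
HB.instance Definition _ :=
  GRing.Lalgebra_isAlgebra.Build R[i] B crossed_scalerAr.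

Fact crossed_starK : involutive crossed_star.
Proof.
by move=> f; apply/ffunP => g; rewrite !ffunE !aut_star starK invgK autVK.
Qed.
Fact crossed_starD : {morph crossed_star : f h / f + h}.
Proof.
by move=> f h; apply/ffunP => g; rewrite !ffunE starD rmorphD.
Qed.
Fact crossed_starM f h :
  crossed_star (f * h) = crossed_star h * crossed_star f.
Proof.
apply/ffunP => k; rewrite !ffunE star_sum rmorph_sum.
rewrite [RHS](reindex_inj (mulgI k)) /=; apply: eq_bigr => g _.
rewrite !ffunE starM rmorphM /= -aut_star -!autM !invMg invgK.
by rewrite mulgKV mulgK invgK mulKg.
Qed.
Fact crossed_starZ (c : R[i]) f :
  crossed_star (c *: f) = c^* *: crossed_star f.
Proof. by apply/ffunP => g; rewrite !ffunE starZ linearZ. Qed.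
HB.instance Definition _ := hasStar.Build R B
  crossed_starK crossed_starD crossed_starM crossed_starZ.

Definition covariant (D : cstarType R) (phi : {lrmorphism A -> D})
    (v : gT -> D) : Prop :=
  [/\ star_preserving phi,
      forall g, is_unitary (v g),
      forall g k, v (g * k)%g = v g * v k
    & forall g a, v g * phi a * star (v g) = phi (alpha g a)].

Definition integrated (D : cstarType R) (phi : {lrmorphism A -> D})
    (v : gT -> D) (f : B) : D := \sum_g phi (f g) * v g.

Definition covariant_norms (f : B) : set R :=
  [set r | exists (D : cstarType R) (phi : {lrmorphism A -> D}) (v : gT -> D),
     covariant phi v /\ r = cnorm (integrated phi v f)].

Lemma covariant_norms_ub (f : B) :
  ubound (covariant_norms f) (\sum_g cnorm (f g)).
Proof.
move=> _ [D [phi [v [[phis vu _ _] ->]]]].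
rewrite (le_trans (cnorm_sum _ _ _))//; apply: ler_sum => g _.
have v1 : cnorm (v g) = 1.
  apply/eqP; rewrite -(@eqrXn2 _ 2%N) ?cnorm_ge0// -cnorm_starM.
  by rewrite (vu g).1 cnorm1 expr1n.
by rewrite (le_trans (cnormM _ _))// v1 mulr1 cnorm_lrmorphism_le.
Qed.

(* The universal C*-norm, the supremum over all covariant pairs. The set is
   bounded by covariant_norms_ub and nonempty because of the regular
   representation. As G is finite, the norm dominates every cnorm (f g), so the
   functions G -> A are already complete and no completion has to be taken. *)
HB.instance Definition _ :=
  hasCNorm.Build R B (fun f => sup (covariant_norms f)).

End CrossedProduct.

(* Main.v *)
(** Let e_g be the Rokhlin projections. They commute with A and are mutually
    orthogonal, so a |-> sum_g e_g alpha_g(a) is a *-homomorphism from A to the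
    fixed points of A^oo which is the identity on A^alpha, and together with the
    matrix units e_g u_(g h^-1) it gives a *-homomorphism from M_G (x) A to the
    sequence algebra of the crossed product whose range contains the crossed
    product. The tensor product of two projections is a projection, so M_G (x) A
    inherits the LP property from A. Finally a sequence of almost projections is
    asymptotically a sequence of projections; for the crossed product this is
    done in the norm sum_g |f(g)|, which dominates the universal norm, is
    complete and makes the involution isometric. *)
Require Import Defs.
From mathcomp Require Import all_boot all_order all_algebra all_fingroup.
From mathcomp Require Import all_classical all_reals all_analysis.
From mathcomp Require Import complex ring lra.

Set Implicit Arguments.
Unset Strict Implicit.
Unset Printing Implicit Defensive.

Import Order.TTheory GRing.Theory Num.Theory.
Import numFieldNormedType.Exports ComplexField.Normc.

Local Open Scope classical_set_scope.
Local Open Scope ring_scope.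

(** * Lifting projections *)

(** Keeps the axioms shared by a C*-norm and the l1 norm of the crossed product: an isometric
    involution takes the place of the C*-identity. *)
Record banach_star_norm (R : realType) (X : starAlgType R) (N : X -> R) :
    Prop := BanachStarNorm {
  bnormD : forall x y : X, N (x + y) <= N x + N y;
  bnormZ : forall (c : R[i]) (x : X), N (c *: x) = normc c * N x;
  bnorm0_eq0 : forall x : X, N x = 0 -> x = 0;
  bnormM : forall x y : X, N (x * y) <= N x * N y;
  bnorm_star : forall x : X, N (star x) = N x;
  bnorm_complete : forall u : nat -> X,
    (forall eps : R, 0 < eps -> exists n0 : nat, forall m n : nat,
      (n0 <= m)%N -> (n0 <= n)%N -> N (u m - u n) < eps) ->
    exists l : X, (fun n => N (u n - l)) @ \oo --> (0 : R)
}.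

Lemma cstar_banach (R : realType) (A : cstarType R) :
  banach_star_norm (@cnorm R A).
Proof.
split; [exact: cnormD|exact: cnormZ|exact: cnorm0_eq0|exact: cnormM
  |exact: cnorm_star|exact: cnorm_complete].
Qed.

Definition null_seq (R : realType) (X : starAlgType R) (N : X -> R)
    (s : nat -> X) : Prop :=
  forall e : R, 0 < e -> \forall n \near \oo, N (s n) < e.

(** The combination of projections may vary with [n]. For a constant sequence this is membership in
    the [N]-closure of the span of the projections. *)
Definition asymptotic_span (R : realType) (X : starAlgType R) (N : X -> R)
    (s : nat -> X) : Prop :=
  forall e : R, 0 < e ->
    \forall n \near \oo, exists2 x, projection_span x & N (s n - x) < e.

Lemma normc_ge0 (R : rcfType) (c : R[i]) : 0 <= normc c.
Proof. by case: c => a b; exact: sqrtr_ge0. Qed.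

Section ProjectionSpan.
Variables (R : realType) (X : starAlgType R).
Implicit Types x y : X.

Lemma projection_span0 : projection_span (0 : X).
Proof.
exists 0, (fun=> 0), (fun=> 0); split=> [[]//|]; by rewrite big_ord0.
Qed.

Lemma projection_spanD x y :
  projection_span x -> projection_span y -> projection_span (x + y).
Proof.
move=> [m [c [p [pP ->]]]] [n [d [q [qP ->]]]].
exists (m + n)%N,
  (fun i => match fintype.split i with inl j => c j | inr j => d j end),
  (fun i => match fintype.split i with inl j => p j | inr j => q j end); split.
  by move=> i; case: fintype.splitP => j _.
rewrite big_split_ord /=; congr (_ + _); apply: eq_bigr => i _.
- by case: split_ordP => j; [move/lshift_inj-> | move/eqP; rewrite eq_lrshift].
- by case: split_ordP => j; [move/eqP; rewrite eq_rlshift | move/rshift_inj->].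
Qed.

Lemma projection_spanZ (a : R[i]) x :
  projection_span x -> projection_span (a *: x).
Proof.
move=> [m [c [p [pP ->]]]]; exists m, (fun i => a * c i), p; split=> //.
by rewrite scaler_sumr; apply: eq_bigr => i _; rewrite scalerA.
Qed.

Lemma projection_span_proj x : is_projection x -> projection_span x.
Proof.
move=> xP; exists 1, (fun=> 1), (fun=> x); split=> //.
by rewrite big_ord1 scale1r.
Qed.

End ProjectionSpan.

(** * Geometric convergence and the algebra of the Newton step *)

Section BanachStar.
Variables (R : realType) (X : starAlgType R) (N : X -> R).
Hypothesis NP : banach_star_norm N.
Implicit Types (x y : X) (s t : nat -> X).

Local Notation null := (null_seq N).

Lemma bnorm0 : N 0 = 0.
Proof. by rewrite -(scale0r (0 : X)) (bnormZ NP) normc0 mul0r. Qed.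

Lemma bnormN x : N (- x) = N x.
Proof. by rewrite -scaleN1r (bnormZ NP) normcN normc1 mul1r. Qed.

Lemma bnorm_ge0 x : 0 <= N x.
Proof.
have := bnormD NP x (- x); rewrite subrr bnorm0 bnormN -mulr2n.
by rewrite pmulrn_lge0.
Qed.

Lemma bnormB x y : N (x - y) <= N x + N y.
Proof. by rewrite -(bnormN y) (bnormD NP). Qed.

Lemma bnorm_distC x y : N (x - y) = N (y - x).
Proof. by rewrite -bnormN opprB. Qed.

Lemma bnormMn x n : N (x *+ n) <= N x *+ n.
Proof.
elim: n => [|n IH]; first by rewrite !mulr0n bnorm0.
by rewrite !mulrS (le_trans (bnormD NP _ _))// lerD2l.
Qed.

Lemma geometric_limit (u : nat -> X) (C : R) :
  (forall k, N (u k.+1 - u k) <= C / 2 ^+ k) ->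
  exists2 l, null (fun n => u n - l) & N (u 0 - l) <= 2 * C.
Proof.
move=> uC.
have C0 : 0 <= C.
  by have := le_trans (bnorm_ge0 _) (uC 0); rewrite expr0 divr1.
(* The subtracted tail keeps the exact partial geometric sum, which lets the induction on [j]
   close. *)
have dist k j : N (u (k + j)%N - u k) <= 2 * C / 2 ^+ k - 2 * C / 2 ^+ (k + j).
  elim: j => [|j IH]; first by rewrite addn0 !subrr bnorm0.
  rewrite addnS -[_.+1 in X in X <= _]/((k + j).+1).
  have -> : u (k + j).+1 - u k = (u (k + j).+1 - u (k + j)%N) +
    (u (k + j)%N - u k).
    by rewrite addrA subrK.
  rewrite (le_trans (bnormD NP _ _))// (le_trans (lerD (uC _) IH))//.
  rewrite exprS invfM; set a := _ / 2 ^+ k; set b := (2 ^+ (k + j))^-1.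
  by lra.
have dist' k j : N (u (k + j)%N - u k) <= 2 * C / 2 ^+ k.
  by rewrite (le_trans (dist k j))// gerBl !mulr_ge0 ?invr_ge0 ?exprn_ge0.
have small e : 0 < e -> exists n0, 2 * C / 2 ^+ n0 < e.
  move=> e0; have h : `|2^-1 : R| < 1 by rewrite ger0_norm; lra.
  have := cvg_expr h => /cvgr0Pnorm_lt /(_ (e / (2 * C + 1))).
  have C1 : 0 < 2 * C + 1 by lra.
  move=> /(_ (divr_gt0 e0 C1)) [n0 _ /(_ n0 (leqnn _))] /=.
  rewrite ger0_norm ?exprn_ge0 ?invr_ge0// ltr_pdivlMr// => H.
  exists n0; rewrite -exprVn (le_lt_trans _ H)//
    mulrC ler_wpM2l ?exprn_ge0 ?invr_ge0//.
  lra.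
have [l ul] : exists l : X, (fun n => N (u n - l)) @ \oo --> (0 : R).
  apply: (bnorm_complete NP) => e e0.
  have [n0 Hn0] := small (e / 2) (divr_gt0 e0 (ltr0Sn _ _)).
  exists n0 => m n nm nn.
  have H k : (n0 <= k)%N -> N (u k - u n0) < e / 2.
    by move=> nk; rewrite -(subnKC nk) (le_lt_trans (dist' _ _)).
  have -> : u m - u n = (u m - u n0) + (u n0 - u n) by rewrite addrA subrK.
  rewrite (le_lt_trans (bnormD NP _ _))// [ltRHS]splitr ltrD ?H//.
  by rewrite bnorm_distC H.
have lnull : null (fun n => u n - l).
  move=> e e0; move/cvgr0Pnorm_lt : ul => /(_ _ e0).
  by apply: filterS => n; rewrite /= ger0_norm ?bnorm_ge0.
exists l => //; apply/ler_addgt0Pl => e e0.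
have [n0 _ /(_ n0 (leqnn n0)) /= H] := lnull e e0.
have -> : u 0 - l = (u n0 - l) + (u 0 - u n0) by rewrite [RHS]addrC addrA subrK.
rewrite (le_trans (bnormD NP _ _))// lerD ?(ltW H)// bnorm_distC.
by have := dist' 0 n0; rewrite add0n expr0 divr1.
Qed.

(** Both sides lie in the commutative image of [{poly R[i]}] under evaluation at [x], so [ring]
    proves the identities for polynomials and [horner_alg x] transports them. *)
Lemma newton_step (x : X) :
  let f := x * x *+ 3 - x * x * x *+ 2 in let d := x * x - x in
  f - x = d - x * d *+ 2 /\ f * f - f = d * d * d *+ 4 - d * d *+ 3.
Proof.
pose P : {poly R[i]} := 'X.
move=> f d; split.
- have := congr1 (horner_alg x) (_ : P * P *+ 3 - P * P * P *+ 2 - P =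
    (P * P - P) - P * (P * P - P) *+ 2).
  rewrite /= !(rmorphB, rmorphM, rmorphMn) /= horner_algX; apply; ring.
- have := congr1 (horner_alg x) (_ :
    (P * P *+ 3 - P * P * P *+ 2) * (P * P *+ 3 - P * P * P *+ 2) -
    (P * P *+ 3 - P * P * P *+ 2) =
    (P * P - P) * (P * P - P) * (P * P - P) *+ 4 -
    (P * P - P) * (P * P - P) *+ 3).
  rewrite !(rmorphB, rmorphM, rmorphMn) /= horner_algX; apply; ring.
Qed.

End BanachStar.

(** * Null sequences and almost projections *)

Section ProjectionLifting.
Variables (R : realType) (X : starAlgType R) (N : X -> R).
Hypothesis NP : banach_star_norm N.
Implicit Types (x y : X) (s t : nat -> X).

Local Notation null := (null_seq N).

Definition bounded_seq_for s := exists M : R, forall n, N (s n) <= M.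

Lemma null_seq_dominated (Y : starAlgType R) (N' : Y -> R) (K : R)
    (s : nat -> X) (t : nat -> Y) :
  (forall n, N (s n) <= K * N' (t n)) -> (forall y : Y, 0 <= N' y) ->
  null_seq N' t -> null s.
Proof.
move=> st N'0 tn e e0.
have K1 : 0 < `|K| + 1 by rewrite ltr_wpDl.
apply: filterS (tn _ (divr_gt0 e0 K1)) => n; rewrite ltr_pdivlMr// => H.
rewrite (le_lt_trans (st n))// (le_lt_trans _ H)// mulrC ler_wpM2l//.
by rewrite (le_trans (ler_norm K))// lerDl.
Qed.

Lemma null_seqD s t : null s -> null t -> null (fun n => s n + t n).
Proof.
move=> sn tn e e0; have e2 : 0 < e / 2 by rewrite divr_gt0.
apply: filterS2 (sn _ e2) (tn _ e2) => n sen ten.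
by rewrite (le_lt_trans (bnormD NP _ _))// [ltRHS]splitr ltrD.
Qed.

Lemma null_seqZ (c : R[i]) s : null s -> null (fun n => c *: s n).
Proof.
apply: (@null_seq_dominated _ _ (normc c)) => [n|y].
  by rewrite (bnormZ NP).
exact: bnorm_ge0.
Qed.

Lemma null_seqN s : null s -> null (fun n => - s n).
Proof.
apply: (@null_seq_dominated _ _ 1) => [n|y]; last exact: bnorm_ge0.
by rewrite mul1r bnormN.
Qed.

Lemma null_seqB s t : null s -> null t -> null (fun n => s n - t n).
Proof. by move=> sn tn; apply: null_seqD => //; exact: null_seqN. Qed.

Lemma null_seq0 : null (fun=> 0).
Proof. by move=> e e0; apply: nearW => n; rewrite (bnorm0 NP). Qed.

Lemma null_seq_sum (I : Type) (r : seq I) (F : I -> nat -> X) :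
  (forall i, null (F i)) -> null (fun n => \sum_(i <- r) F i n).
Proof.
move=> Fn; elim: r => [|i r IH].
  by under [X in null X]funext do rewrite big_nil; exact: null_seq0.
under [X in null X]funext do rewrite big_cons.
exact: null_seqD.
Qed.

Lemma null_seq_star s : null s -> null (fun n => star (s n)).
Proof.
apply: (@null_seq_dominated _ _ 1) => [n|y]; last exact: bnorm_ge0.
by rewrite mul1r (bnorm_star NP).
Qed.

Lemma null_seqMl s t : bounded_seq_for s -> null t ->
  null (fun n => s n * t n).
Proof.
move=> [M sM]; apply: (@null_seq_dominated _ _ M) => [n|y].
  by rewrite (le_trans (bnormM NP _ _))// ler_wpM2r// (bnorm_ge0 NP).
exact: bnorm_ge0.
Qed.

Lemma null_seqMr s t : bounded_seq_for s -> null t ->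
  null (fun n => t n * s n).
Proof.
move=> [M sM]; apply: (@null_seq_dominated _ _ M) => [n|y].
  by rewrite (le_trans (bnormM NP _ _))// mulrC ler_wpM2r// (bnorm_ge0 NP).
exact: bnorm_ge0.
Qed.

Lemma null_seq_cst x : null (fun=> x) -> x = 0.
Proof.
move=> H; apply: (bnorm0_eq0 NP); apply/eqP; rewrite eq_le (bnorm_ge0 NP) andbT.
apply/ler_addgt0Pl => e e0; rewrite addr0.
by have [n _ /(_ n (leqnn n)) /ltW] := H e e0.
Qed.

Lemma bounded_seq_sum (I : Type) (r : seq I) (F : I -> nat -> X) :
  (forall i, bounded_seq_for (F i)) ->
  bounded_seq_for (fun n => \sum_(i <- r) F i n).
Proof.
move=> FM; elim: r => [|i r [M HM]].
  by exists 0 => n; rewrite big_nil (bnorm0 NP).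
have [K HK] := FM i; exists (K + M) => n.
by rewrite big_cons (le_trans (bnormD NP _ _))// lerD.
Qed.

Lemma bounded_seqZ (c : R[i]) s : bounded_seq_for s ->
  bounded_seq_for (fun n => c *: s n).
Proof.
move=> [M sM]; exists (normc c * M) => n; rewrite (bnormZ NP) ler_wpM2l//.
exact: normc_ge0.
Qed.

(* Newton's iteration x |-> 3 x^2 - 2 x^3 maps the defect d = x^2 - x to
   4 d^3 - 3 d^2, so it converges quadratically to a projection. *)
Lemma close_projection (M e : R) : 0 <= M -> 0 < e ->
  exists2 d, 0 < d & forall x, star x = x -> N x <= M -> N (x * x - x) <= d ->
    exists2 p, is_projection p & N (x - p) <= e.
Proof.
move=> M0 e0; set m := Num.min 1 e.
have m0 : 0 < m by rewrite lt_min ltr01.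
have [m1 me] : m <= 1 /\ m <= e by rewrite /m !ge_min !lexx orbT.
(* [K] will bound every iterate, and [L] then bounds the factor [1 - 2 x] in the step
   [f - x = d - 2 x d]. *)
have [K KE] : exists K, K = M + 1 by exists (M + 1).
have [L LE] : exists L, L = 1 + 2 * K by exists (1 + 2 * K).
have L3 : 3 <= L by lra.
(* A defect [z <= 1 / 14] becomes at most [4 z^3 + 3 z^2 <= 7 z / 14 = z / 2], so defects halve. The
   displacements then add up to at most [2 * (L * d) = m / 7], below both [1] and [e]. *)
have [d d0 Ld] : exists2 d, 0 < d & 14 * (L * d) = m.
  have L1 : 0 < 14 * L by lra.
  by exists (m / (14 * L)); [rewrite divr_gt0|field; rewrite gt_eqF//; lra].
have d14 : 14 * d <= 1.
  have : d <= L * d by apply: ler_peMl; [exact: ltW|lra].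
  lra.
exists d => // x sx xM xd.
pose f (y : X) := y * y *+ 3 - y * y * y *+ 2.
pose u k := iter k f x; pose D k := u k * u k - u k.
have uS k : u k.+1 = f (u k) by [].
have su k : star (u k) = u k.
  elim: k => //= k IH; rewrite /f starD starN.
  have sMn (y : X) n : star (y *+ n) = star y *+ n.
    by elim: n => [|n IHn]; rewrite ?star0// !mulrS starD IHn.
  by rewrite !sMn !starM IH mulrA.
have p2 k : 0 < (2 ^+ k : R)^-1 by rewrite invr_gt0 exprn_gt0.
have p2le k : (2 ^+ k : R)^-1 <= 1 by rewrite invf_le1 ?exprn_gt0//
  exprn_ege1// ler1n.
have uK k : N (u k - x) <= L * d * 2 * (1 - (2 ^+ k)^-1) -> N (u k) <= K.
  move=> H; have -> : u k = x + (u k - x) by rewrite addrC subrK.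
  rewrite (le_trans (bnormD NP _ _))// KE lerD// (le_trans H)//.
  have : L * d * 2 * (1 - (2 ^+ k)^-1) <= L * d * 2 * 1.
    by rewrite ler_wpM2l// ?gerBl ?(ltW (p2 k))// !mulr_ge0//; lra.
  lra.
have step k : N (u k) <= K -> N (D k) <= d / 2 ^+ k ->
    N (u k.+1 - u k) <= L * d / 2 ^+ k.
  move=> uk Dk; have [E1 _] := newton_step (u k).
  rewrite uS /f E1 (le_trans (bnormB NP _ _))//.
  have H1 : N (u k * D k *+ 2) <= K * N (D k) *+ 2.
    rewrite (le_trans (bnormMn NP _ _))// lerMn2r /=.
    by rewrite (le_trans (bnormM NP _ _))// ler_wpM2r// (bnorm_ge0 NP).
  rewrite (le_trans (lerD (lexx _) H1))// -mulr_natr.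
  have : L * N (D k) <= L * (d / 2 ^+ k) by rewrite ler_wpM2l//; lra.
  by rewrite mulrA; rewrite {1}LE; lra.
(* The next displacement needs the current defect and [N (u k) <= K], which itself follows from the
   current displacement; hence the joint induction. *)
have inv k : N (D k) <= d / 2 ^+ k /\
    N (u k - x) <= L * d * 2 * (1 - (2 ^+ k)^-1).
  elim: k => [|k [IHd IHu]].
    by rewrite /D /u /= expr0 divr1 invr1 !subrr mulr0 (bnorm0 NP).
  have dk0 : 0 <= N (D k) by exact: bnorm_ge0.
  have Dle : N (D k) <= d.
    by rewrite (le_trans IHd)// ler_piMr// ltW.
  split.
    have [_ E2] := newton_step (u k); rewrite -/(D k) in E2.
    rewrite /D uS /f E2 (le_trans (bnormB NP _ _))//.
    apply: (@le_trans _ _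
      (N (D k) * N (D k) * N (D k) *+ 4 + N (D k) * N (D k) *+ 3)).
      rewrite lerD// (le_trans (bnormMn NP _ _))// lerMn2r /=.
        rewrite (le_trans (bnormM NP _ _))// ler_wpM2r//.
        exact: (bnormM NP).
      exact: (bnormM NP).
    have -> : d / 2 ^+ k.+1 = d / 2 ^+ k / 2 by rewrite exprS invfM; lra.
    apply: (@le_trans _ _ (N (D k) / 2)); last lra.
    rewrite -mulr_natr -[_ *+ 3]mulr_natr.
    have : N (D k) * N (D k) <= N (D k) / 14.
      by rewrite ler_wpM2l//; lra.
    move: (N (D k)) dk0 Dle => z z0 zd zz.
    have : z * z * z <= z / 14 * 1.
      by apply: ler_pM => //; [rewrite mulr_ge0|lra].
    lra.
  have -> : u k.+1 - x = (u k.+1 - u k) + (u k - x) by rewrite addrA subrK.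
  rewrite (le_trans (bnormD NP _ _))//.
  rewrite (le_trans (lerD (step k (uK k IHu) IHd) IHu))//.
  rewrite exprS invfM; lra.
have [p pl xp] := geometric_limit NP (fun k =>
  step k (uK k (inv k).2) (inv k).1).
have ub : bounded_seq_for u by exists K => k; rewrite uK//; have [] := inv k.
have Dn : null D.
  move=> e' e'0; have h : `|2^-1 : R| < 1 by rewrite ger0_norm; lra.
  have := cvg_expr h => /cvgr0Pnorm_lt /(_ _ e'0).
  apply: filterS => k /=; rewrite ger0_norm ?exprn_ge0 ?invr_ge0// => H.
  rewrite (le_lt_trans (inv k).1)// (le_lt_trans _ H)//.
  by rewrite exprVn ler_piMl ?(ltW (p2 k))//; lra.
exists p; last by rewrite (le_trans xp)//; lra.
split; apply/eqP; rewrite -subr_eq0; apply/eqP/null_seq_cst.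
- have E n : p * p - p = D n - (u n * (u n - p) + (u n - p) * p) + (u n - p).
    have -> : u n * (u n - p) + (u n - p) * p = u n * u n - p * p.
      by rewrite mulrBr mulrBl addrA subrK.
    by rewrite opprB [D n + _]addrC /D !addrA !subrK.
  under [X in null X]funext => n do rewrite (E n).
  apply: null_seqD => //; apply: null_seqB => //; apply: null_seqD.
    exact: null_seqMl.
  by apply: (@null_seqMr (fun=> p)) => //; exists (N p).
- have E n : star p - p = (u n - p) - star (u n - p).
    by rewrite starD starN su opprB [RHS]addrC addrA subrK.
  under [X in null X]funext => n do rewrite (E n).
  by apply: null_seqB => //; exact: null_seq_star.
Qed.

Lemma asymptotic_spanD s t : asymptotic_span N s -> asymptotic_span N t ->
  asymptotic_span N (fun n => s n + t n).
Proof.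
move=> sL tL e e0; have e2 : 0 < e / 2 by rewrite divr_gt0.
apply: filterS2 (sL _ e2) (tL _ e2) => n [x xs sx] [y ys ty].
exists (x + y); first exact: projection_spanD.
rewrite opprD addrACA (le_lt_trans (bnormD NP _ _))//.
by rewrite [ltRHS]splitr ltrD.
Qed.

Lemma asymptotic_span_sum (I : Type) (r : seq I) (F : I -> nat -> X) :
  (forall i, asymptotic_span N (F i)) ->
  asymptotic_span N (fun n => \sum_(i <- r) F i n).
Proof.
move=> FL; elim: r => [|i r IH].
  move=> e e0; apply: nearW => n; exists 0; first exact: projection_span0.
  by rewrite big_nil subrr (bnorm0 NP).
under [X in asymptotic_span _ X]funext do rewrite big_cons.
exact: asymptotic_spanD.
Qed.

Lemma asymptotic_spanZ (c : R[i]) s : asymptotic_span N s ->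
  asymptotic_span N (fun n => c *: s n).
Proof.
move=> sL e e0.
have c1 : 0 < normc c + 1 by rewrite ltr_wpDl// normc_ge0.
apply: filterS (sL _ (divr_gt0 e0 c1)) => n [x xs].
rewrite ltr_pdivlMr// => sx; exists (c *: x); first exact: projection_spanZ.
rewrite -scalerBr (bnormZ NP) (le_lt_trans _ sx)// mulrC.
by rewrite ler_wpM2l ?(bnorm_ge0 NP)// lerDl.
Qed.

Lemma asymptotic_span_approx s :
  (forall e, 0 < e -> exists2 t, asymptotic_span N t &
    \forall n \near \oo, N (s n - t n) < e) -> asymptotic_span N s.
Proof.
move=> H e e0; have e2 : 0 < e / 2 by rewrite divr_gt0.
have [t tL st] := H _ e2.
apply: filterS2 (tL _ e2) st => n [x xs tx] stn; exists x => //.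
have -> : s n - x = (s n - t n) + (t n - x) by rewrite addrA subrK.
by rewrite (le_lt_trans (bnormD NP _ _))// [ltRHS]splitr ltrD.
Qed.

Lemma asymptotic_span_eq s t : asymptotic_span N t ->
  null (fun n => s n - t n) -> asymptotic_span N s.
Proof.
by move=> tL st; apply: asymptotic_span_approx => e e0; exists t => //;
  exact: st.
Qed.

(** The self-adjoint part [t n] of [s n] differs from it by a null sequence and is still almost
    idempotent, so [close_projection] applies to [t n] for large [n]. *)
Lemma asymptotic_span_projections s : bounded_seq_for s ->
  null (fun n => s n * s n - s n) -> null (fun n => star (s n) - s n) ->
  asymptotic_span N s.
Proof.
move=> sb ss sS; pose h : R[i] := 2^-1; pose t n := h *: (star (s n) + s n).
have [M sM] := sb.
have h2 (x : X) : h *: (x + x) = x.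
  by rewrite scalerDr -scalerDl -mulr2n -mulr_natr mulVf ?scale1r ?pnatr_eq0.
have ts : null (fun n => t n - s n).
  have E n : t n - s n = h *: (star (s n) - s n).
    by rewrite /t -{3}(h2 (s n)) -scalerBr opprD addrA addrK.
  under [X in null X]funext => n do rewrite (E n).
  exact: null_seqZ.
apply: (@asymptotic_span_eq _ t); last first.
  by under [X in null X]funext => n do rewrite -opprB; exact: null_seqN.
have tb : bounded_seq_for t.
  exists (normc h * (M + M)) => n; rewrite (bnormZ NP) ler_wpM2l//.
    exact: normc_ge0.
  by rewrite (le_trans (bnormD NP _ _))// (bnorm_star NP) lerD.
have tt : null (fun n => t n * t n - t n).
  have E n : t n * t n - t n =
      (s n * s n - s n) + (t n * (t n - s n) + (t n - s n) * s n) - (t n - s n).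
    have -> : t n * (t n - s n) + (t n - s n) * s n = t n * t n - s n * s n.
      by rewrite mulrBr mulrBl addrA subrK.
    by rewrite [s n * s n - _ + _]addrC opprB !addrA !subrK.
  under [X in null X]funext => n do rewrite (E n).
  apply: null_seqB => //; apply: null_seqD => //; apply: null_seqD.
    exact: null_seqMl.
  exact: null_seqMr.
have st n : star (t n) = t n.
  rewrite starZ starD starK addrC; congr (_ *: _).
  by rewrite /h fmorphV /= conjC_nat.
move=> e e0; have [M' tM] := tb.
have [d d0 H] := close_projection (normr_ge0 M') (divr_gt0 e0 (ltr0Sn R 1)).
apply: filterS (tt _ d0) => n tn.
have [|p pP tp] := H (t n) (st n) _ (ltW tn).
  by rewrite (le_trans (tM n))// ler_norm.
exists p; first exact: projection_span_proj.
by rewrite (le_lt_trans tp)// ltr_pdivrMr// ltr_pMr// ltr1n.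
Qed.

End ProjectionLifting.

Lemma LP_of_asymptotic_span (R : realType) (X : preCStarType R) (N : X -> R) :
  (forall x, cnorm x <= N x) ->
  (forall a : X, asymptotic_span N (fun=> a)) -> LP_property X.
Proof.
move=> cN H a e e0; have [n _ /(_ n (leqnn n)) [x xs ax]] := H a e e0.
by exists x => //; rewrite (le_lt_trans (cN _)).
Qed.

(** * The l1 norm on the crossed product *)

Section CrossedL1.
Variables (gT : finGroupType) (R : realType) (A : cstarType R).
Variable alpha : cstar_action gT A.
Local Notation B := (crossed_product alpha).
Implicit Types f h : B.

Definition l1norm f : R := \sum_g cnorm (f g).

(** Submultiplicativity is the l1 estimate for a convolution twisted by isometries. Completeness
    holds coefficient by coefficient, as [gT] is finite. *)
Lemma l1norm_banach : banach_star_norm l1norm.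
Proof.
split.
- move=> f h; rewrite /l1norm -big_split /=; apply: ler_sum => g _.
  by rewrite ffunE cnormD.
- move=> c f; rewrite /l1norm mulr_sumr; apply: eq_bigr => g _.
  by rewrite ffunE cnormZ.
- move=> f /eqP; rewrite psumr_eq0; last by move=> g _; exact: cnorm_ge0.
  move=> /allP f0; apply/ffunP => g; rewrite ffunE; apply/cnorm0_eq0/eqP.
  exact: (f0 g (mem_index_enum g)).
- move=> f h; rewrite /l1norm mulr_suml.
  apply: (@le_trans _ _ (\sum_k \sum_g cnorm (f g) * cnorm (h (g^-1 * k)%g))).
    apply: ler_sum => k _; rewrite ffunE (le_trans (cnorm_sum _ _ _))//.
    by apply: ler_sum => g _; rewrite (le_trans (cnormM _ _))// cnorm_aut.
  rewrite exchange_big /=; apply: ler_sum => g _.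
  by rewrite -mulr_sumr [in leRHS](reindex_inj (mulgI g^-1%g)).
- move=> f; rewrite /l1norm [RHS](reindex_inj invg_inj) /=.
  by apply: eq_bigr => g _; rewrite ffunE cnorm_aut cnorm_star.
- move=> u uC.
  have coord g : exists l : A, (fun n => cnorm (u n g - l)) @ \oo --> (0 : R).
    apply: cnorm_complete => e /uC[n0 H]; exists n0 => m n nm nn.
    apply: le_lt_trans (H m n nm nn); rewrite /l1norm (bigD1 g) //= !ffunE.
    by rewrite lerDl sumr_ge0// => i _; exact: cnorm_ge0.
  have [l lP] := choice coord; exists [ffun g => l g].
  rewrite (_ : (fun n => _) = fun n => \sum_g cnorm (u n g - l g)); last first.
    by apply/funext => n; apply: eq_bigr => g _; rewrite !ffunE.
  elim: (index_enum gT) => [|g r IH].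
    rewrite (_ : (fun n => _) = fun=> 0); first exact: cvg_cst.
    by apply/funext => n; rewrite big_nil.
  rewrite (_ : (fun n => _) = (fun n => cnorm (u n g - l g)) +
    (fun n => \sum_(h <- r) cnorm (u n h - l h))).
    by rewrite -[X in _ --> X](addr0 0); exact: cvgD.
  by apply/funext => n; rewrite big_cons.
Qed.

Lemma crossed_cnorm_le_l1 f : cnorm f <= l1norm f.
Proof.
(* The default value of [sup] on the empty set is 0, so the bound holds in that case too. *)
have [S0|S0] := eqVneq (covariant_norms f) set0.
  rewrite (_ : cnorm f = 0) ?sumr_ge0// => [g _|]; first exact: cnorm_ge0.
  by rewrite -[LHS]/(sup (covariant_norms f)) S0 sup0.
by apply: ge_sup; [exact/set0P|exact: covariant_norms_ub].
Qed.

End CrossedL1.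

(** * Orthogonality of partitions of unity in the sequence algebra *)

Section AsymptoticBound.
Variables (R : realType) (A : cstarType R).
Local Notation Ainf := (Ainfty A).
Implicit Types (s t : linfty A) (x y : Ainf).

(* The quotient norm of x is at most c. *)
Definition inf_bound (c : R) x : Prop :=
  exists2 s, x = cls s &
    forall e, 0 < e -> \forall n \near \oo, cnorm (s n) < c + e.

Lemma c0_near s (e : R) : s \in @c0_pred R A -> 0 < e ->
  \forall n \near \oo, cnorm (s n) < e.
Proof.
move=> /c0P /cvgr0Pnorm_lt H e0; apply: filterS (H _ e0) => n /=.
by rewrite ger0_norm ?cnorm_ge0.
Qed.

Lemma cls_near s t (e : R) : cls s = cls t -> 0 < e ->
  \forall n \near \oo, cnorm (s n - t n) < e.
Proof. by move=> /cls_eq; exact: c0_near. Qed.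

Lemma inf_bound_cls c s : inf_bound c (cls s) ->
  forall e, 0 < e -> \forall n \near \oo, cnorm (s n) < c + e.
Proof.
move=> [t st tc] e e0; have e2 : 0 < e / 2 by rewrite divr_gt0.
apply: filterS2 (cls_near st e2) (tc _ e2) => n H1 H2.
have -> : s n = (s n - t n) + t n by rewrite subrK.
rewrite (le_lt_trans (cnormD _ _))//; lra.
Qed.

Lemma inf_boundD c d x y : inf_bound c x -> inf_bound d y ->
  inf_bound (c + d) (x + y).
Proof.
move=> [s -> sc] [t -> td]; exists (s + t); first by rewrite clsD.
move=> e e0; have e2 : 0 < e / 2 by rewrite divr_gt0.
apply: filterS2 (sc _ e2) (td _ e2) => n H1 H2.
rewrite (le_lt_trans (cnormD _ _))//; lra.
Qed.

Lemma inf_boundZ (a : R[i]) c x : inf_bound c x ->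
  inf_bound (normc a * c) (a *: x).
Proof.
move=> [s -> sc]; exists (a *: s); first by rewrite clsZ.
move=> e e0.
have a0 : 0 <= normc a by exact: normc_ge0.
have a1 : 0 < normc a + 1 by rewrite ltr_wpDl.
apply: filterS (sc _ (divr_gt0 e0 a1)) => n H.
rewrite [X in cnorm X](_ : _ = a *: s n)// cnormZ.
have [->|an0] := eqVneq (normc a) 0; first by rewrite !mul0r add0r.
have ap : 0 < normc a by rewrite lt0r an0.
rewrite (lt_le_trans (_ : _ < normc a * (c + e / (normc a + 1))))//.
  by rewrite ltr_pM2l.
rewrite mulrDr lerD2l mulrCA ger_pMr// ler_pdivrMr// mul1r lerDl//.
Qed.

Lemma inf_boundW c d x : c <= d -> inf_bound c x -> inf_bound d x.
Proof.
move=> cd [s -> sc]; exists s => // e e0; apply: filterS (sc e e0) => n H.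
by rewrite (lt_le_trans H)// lerD2r.
Qed.

Lemma inf_boundM x y : inf_bound 1 x -> inf_bound 1 y -> inf_bound 1 (x * y).
Proof.
(* For [0 <= d <= 1] one has [(1 + d)^2 <= 1 + 3 d], whence the choice [d = min 1 (e / 3)]. *)
move=> [s -> sc] [t -> td]; exists (s * t); first by rewrite clsM.
move=> e e0; have e2 : 0 < Num.min 1 (e / 3).
  by rewrite lt_min ltr01 divr_gt0.
have : Num.min 1 (e / 3) <= 1 /\ Num.min 1 (e / 3) <= e / 3.
  by rewrite !ge_min !lexx orbT.
move: (Num.min _ _) e2 => d d0 [d1 de].
apply: filterS2 (sc _ d0) (td _ d0) => n H1 H2.
rewrite linftyM (le_lt_trans (cnormM _ _))//.
rewrite (lt_le_trans (_ : _ < (1 + d) * (1 + d)))//.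
  by rewrite ltr_pM ?cnorm_ge0.
nra.
Qed.

Lemma inf_bound_star c x : 0 <= c -> inf_bound (c ^+ 2) (star x * x) ->
  inf_bound c x.
Proof.
move=> c0; have [s ->] := clsP x; rewrite cls_star -clsM => /inf_bound_cls H.
exists s => // e e0; have e2 : 0 < e ^+ 2 by rewrite exprn_gt0.
apply: filterS (H _ e2) => n.
rewrite linftyM [X in cnorm X](_ : _ = star (s n) * s n)// cnorm_starM => sn.
rewrite ltNge; apply/negP => ce; have := cnorm_ge0 (s n).
move: (cnorm (s n)) sn ce => z; nra.
Qed.

Lemma inf_bound_eq0 x : (forall c, 0 < c -> inf_bound c x) -> x = 0.
Proof.
have [s ->] := clsP x => H.
have -> : (0 : Ainf) = cls 0.
  by apply: (addrI (cls 0)); rewrite -clsD !addr0.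
apply/cls_eq; rewrite subr0; apply/c0P/cvgr0Pnorm_lt => e e0.
have e2 : 0 < e / 2 by rewrite divr_gt0.
apply: filterS (inf_bound_cls (H _ e2) e2) => n.
by rewrite -splitr ger0_norm ?cnorm_ge0.
Qed.

(** The C*-identity gives [|s n|^2 < |s n| + e] eventually for a representative [s], which forces
    [|s n| < 1 + e]. *)
Lemma inf_bound_proj x : is_projection x -> inf_bound 1 x.
Proof.
move=> [xx sx]; have [s xE] := clsP x; exists s => // e e0.
have : star x * x = x by rewrite sx xx.
rewrite xE cls_star -clsM => H; apply: filterS (cls_near H e0) => n {}H.
have := cnorm_starM (s n); have := cnormD (star (s n) * s n - s n) (s n).
rewrite subrK; move: H; rewrite linftyM [(star s) n](_ : _ = star (s n))// =>
  H1 H2 H3.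
have := cnorm_ge0 (s n); rewrite ltNge => z0; apply/negP.
move: (cnorm (s n)) (cnorm _) (cnorm _) H1 H2 H3 z0 => z w v; nra.
Qed.

Lemma inf_bound_sum (I : finType) (P : pred I) (F : I -> Ainf) :
  (forall i, P i -> inf_bound 1 (F i)) ->
  inf_bound #|P|%:R (\sum_(i | P i) F i).
Proof.
move=> FP; rewrite -sum1_card natr_sum.
elim/big_rec2: _ => [|i y1 y2 Pi IH]; last exact: inf_boundD (FP i Pi) IH.
have := inf_boundZ 0 (inf_bound_proj (x := 0) _).
by rewrite normc0 mul0r scale0r; apply; split; rewrite ?mul0r ?star0.
Qed.

End AsymptoticBound.

(** * Extremality of the unit of a corner, and orthogonality *)

Section ExtremePoint.
Variables (R : realType) (A : cstarType R).
Local Notation Ainf := (Ainfty A).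
Implicit Types (x y e : Ainf).

Lemma normc_ge0_real (a : R) : 0 <= a -> normc a%:C%C = a.
Proof. by move=> a0; rewrite /= expr0n addr0 sqrtr_sqr ger0_norm. Qed.

Lemma inf_boundZr (a c d : R) x : 0 <= a -> a * c = d -> inf_bound c x ->
  inf_bound d (a%:C%C *: x).
Proof.
move=> a0 <- /(inf_boundZ a%:C%C).
by rewrite normc_ge0_real.
Qed.

Lemma inf_boundMn c x n : inf_bound c x -> inf_bound (c *+ n) (x *+ n).
Proof.
move=> /(inf_boundZr (ler0n R n) (mulr_natl _ _)).
by rewrite rmorph_nat scaler_nat.
Qed.

Lemma scaleVMn (V : lmodType R[i]) (v : V) n :
  (n.+1%:R^-1 : R)%:C%C *: (v *+ n.+1) = v.
Proof.
rewrite -[v *+ _]scaler_nat scalerA fmorphV rmorph_nat mulVf ?scale1r//.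
Qed.

Lemma inf_boundN c x : inf_bound c x -> inf_bound c (- x).
Proof. by move=> /(inf_boundZ (-1)); rewrite normcN normc1 mul1r scaleN1r. Qed.

Lemma inf_bound0 c : 0 <= c -> inf_bound c (0 : Ainf).
Proof.
move=> c0; apply: (inf_boundW c0).
have P0 : is_projection (0 : Ainf) by split; rewrite ?mul0r ?star0.
by have := inf_boundZ 0 (inf_bound_proj P0); rewrite normc0 mul0r scale0r.
Qed.

Section Corner.
Variable e : Ainf.
Hypothesis eP : is_projection e.

(** A self-adjoint direction in the corner cut out by [e] along which [e + x] and [e - x] both stay
    in the unit ball. That only [x = 0] qualifies expresses that the unit of a C*-algebra is an
    extreme point of the unit ball. *)
Definition selfadjoint_gap x : Prop :=
  [/\ star x = x, e * x = x, x * e = x,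
    inf_bound 1 (e + x) & inf_bound 1 (e - x)].

(** The unit of the corner is [e], so a polynomial is evaluated there as [horner_alg x P * e]. This
    is multiplicative because [e] is idempotent and commutes with polynomials in [x]. *)
Lemma corner_horner x : e * x = x -> x * e = x ->
  forall P Q : {poly R[i]}, (horner_alg x P * e) * (horner_alg x Q * e) =
    horner_alg x (P * Q) * e.
Proof.
move=> ex xe P Q; have C : e * horner_alg x Q = horner_alg x Q * e.
  elim/poly_ind: Q => [|Q c IH]; first by rewrite rmorph0 mulr0 mul0r.
  rewrite rmorphD rmorphM /= horner_algX horner_algC mulrDr mulrDl.
  rewrite mulrA IH -!mulrA ex xe; congr (_ + _).
  by rewrite -scalerAl -scalerAr mul1r mulr1.
by rewrite rmorphM -!mulrA [e * _]mulrA C -!mulrA eP.1.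
Qed.

(* With K = {x : |e + x| <= 1 and |e - x| <= 1}, the C*-identity puts i x in K,
   and 8 + 12 X = 3 (1 + X)^3 + (1 + i X)^3 + (1 - i X)^3 + 3 (1 + X)^2 (1 - X)
   puts 3/2 x in K. *)
Lemma gap_dilation x : selfadjoint_gap x ->
  inf_bound 1 (e + (3 / 2 : R)%:C%C *: x).
Proof.
move=> [sx ex xe Up Um].
pose ev (P : {poly R[i]}) := horner_alg x P * e.
pose I : {poly R[i]} := ('i%C)%:P; pose X : {poly R[i]} := 'X.
have II : I * I = -1 by rewrite -polyCM -expr2 sqr_i polyCN.
have evD P Q : ev (P + Q) = ev P + ev Q by rewrite /ev rmorphD mulrDl.
have evN P : ev (- P) = - ev P by rewrite /ev rmorphN mulNr.
have evM P Q : ev P * ev Q = ev (P * Q) by exact: corner_horner.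
have evMn P n : ev (P *+ n) = ev P *+ n by rewrite /ev rmorphMn mulrnAl.
have ev1 : ev 1 = e by rewrite /ev rmorph1 mul1r.
have evX : ev X = x by rewrite /ev /X /= horner_algX.
have evI : ev (I * X) = 'i%C *: x.
  by rewrite /ev rmorphM /= horner_algX horner_algC -mulrA xe -scalerAl mul1r.
have U P Q : inf_bound 1 (ev P) -> inf_bound 1 (ev Q) ->
  inf_bound 1 (ev (P * Q)).
  by rewrite -evM; exact: inf_boundM.
have {}Up : inf_bound 1 (ev (1 + X)) by rewrite evD ev1 evX.
have {}Um : inf_bound 1 (ev (1 - X)) by rewrite evD evN ev1 evX.
have ic : ('i%C : R[i])^* = - 'i%C by apply/eqP;
  rewrite eq_complex /= oppr0 !eqxx.
have sP : star (ev (1 + I * X)) = ev (1 - I * X).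
  by rewrite !evD evN ev1 evI starD starZ sx eP.2 ic scaleNr.
have sM : star (ev (1 - I * X)) = ev (1 + I * X) by rewrite -sP starK.
(* [1 + X * X] is the mean of the squares of the contractions [1 + X] and [1 - X]. It equals
   [(1 - I * X) * (1 + I * X)], which yields the two bounds that follow. *)
have V : inf_bound 1 (ev (1 + X * X)).
  have -> : ev (1 + X * X) =
      (2^-1 : R)%:C%C *: ev ((1 + X) * (1 + X) + (1 - X) * (1 - X)).
    have -> : (1 + X) * (1 + X) + (1 - X) * (1 - X) = (1 + X * X) *+ 2 by ring.
    by rewrite evMn scaleVMn.
  apply: (@inf_boundZr _ (1 + 1)); rewrite ?invr_ge0//; first by field.
  by rewrite evD; apply: inf_boundD; apply: U.
have UI : inf_bound 1 (ev (1 + I * X)).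
  apply: inf_bound_star => //; rewrite expr1n sP evM.
  have -> : (1 - I * X) * (1 + I * X) = 1 - (I * I) * (X * X) by ring.
  by rewrite II mulN1r opprK.
have UI' : inf_bound 1 (ev (1 - I * X)).
  apply: inf_bound_star => //; rewrite expr1n sM evM.
  have -> : (1 + I * X) * (1 - I * X) = 1 - (I * I) * (X * X) by ring.
  by rewrite II mulN1r opprK.
have E : (1 : {poly R[i]}) *+ 8 + X *+ 12 =
    ((1 + X) * (1 + X) * (1 + X)) *+ 3 +
    (1 + I * X) * (1 + I * X) * (1 + I * X) +
    (1 - I * X) * (1 - I * X) * (1 - I * X) +
      ((1 + X) * (1 + X) * (1 - X)) *+ 3.
  have H : (1 + I * X) * (1 + I * X) * (1 + I * X) +
    (1 - I * X) * (1 - I * X) * (1 - I * X) = 2 + (I * I) * (X * X) * 6 by ring.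
  by rewrite -[_ + _ + _ * _ * (1 - I * X)]addrA H II; ring.
have H8 : inf_bound 8 (ev (1 *+ 8 + X *+ 12)).
  have -> : (8 : R) = 1 *+ 3 + 1 + 1 + 1 *+ 3 by ring.
  rewrite E 3!evD !evMn; apply: inf_boundD; last exact/inf_boundMn/U/Um/U.
  apply: inf_boundD; last by apply: (U) => //; exact: U.
  apply: inf_boundD; last by apply: (U) => //; exact: U.
  by apply: inf_boundMn; apply: (U) => //; exact: U.
have /= := @inf_boundZr 8^-1 _ 1 _ _ _ H8.
rewrite mulVf// invr_ge0 ler0n => /(_ isT erefl).
rewrite evD !evMn ev1 evX scalerDr scaleVMn -[x *+ 12]scaler_nat scalerA.
rewrite -(rmorph_nat (real_complex R)) -rmorphM.
by have -> : 8^-1 * 12 = 3 / 2 :> R by field.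
Qed.

(** By iterated dilation [(3/2)^m x] is again a gap. As half the difference of [e + z] and [e - z],
    a gap [z] has norm at most 1, so [x] has norm at most [(2/3)^m] for every [m]. *)
Lemma gap_eq0 x : selfadjoint_gap x -> x = 0.
Proof.
move=> gx; pose r : R[i] := (3 / 2 : R)%:C%C; pose q : R[i] := (2 / 3 : R)%:C%C.
have rc : r^* = r by apply/eqP; rewrite eq_complex /= oppr0 !eqxx.
have qr : q * r = 1 by rewrite -rmorphM (_ : 2 / 3 * (3 / 2) = 1 :> R)//; field.
have gap m : selfadjoint_gap (r ^+ m *: x).
  elim: m => [|m IH]; first by rewrite expr0 scale1r.
  have [sz ez ze Up Um] := IH; rewrite exprS -scalerA.
  split.
  - by rewrite starZ sz rc.
  - by rewrite -scalerAr ez.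
  - by rewrite -scalerAl ze.
  - exact: gap_dilation.
  (* [gap_dilation] bounds only the sum with [e]; the difference is its instance at the opposite
     element. *)
  - rewrite -scalerN; apply: gap_dilation; split.
    + by rewrite starN sz.
    + by rewrite mulrN ez.
    + by rewrite mulNr ze.
    + by [].
    + by rewrite opprK.
have small m : inf_bound ((2 / 3) ^+ m) x.
  have [_ _ _ Up Um] := gap m; set z := r ^+ m *: x in Up Um.
  have z1 : inf_bound 1 z.
    have -> : z = (2^-1 : R)%:C%C *: ((e + z) - (e - z)).
      by rewrite opprB [e + z]addrC addrACA subrr addr0 -mulr2n scaleVMn.
    apply: (@inf_boundZr _ (1 + 1)); rewrite ?invr_ge0//; first by field.
    by apply: inf_boundD => //; exact: inf_boundN.
  have := @inf_boundZr ((2 / 3) ^+ m) _ _ _ _ (mulr1 _) z1.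
  rewrite exprn_ge0 ?divr_ge0// => /(_ isT).
  rewrite rmorphXn /= -/q /z scalerA -exprMn qr expr1n scale1r.
  by [].
apply: inf_bound_eq0 => c c0.
have h : `|2 / 3 : R| < 1 by rewrite ger0_norm; lra.
have := cvg_expr h => /cvgr0Pnorm_lt /(_ _ c0) [m _ /(_ m (leqnn m))] /=.
rewrite ger0_norm ?exprn_ge0 ?divr_ge0// => H.
exact: inf_boundW (ltW H) (small m).
Qed.

End Corner.

(* In a sum of projections equal to 1, each x = p_g p_h p_g lies between 0 and
   p_g, while the compressions by p_g of the others bound - x / m above. *)
Lemma partition_orthogonal (I : finType) (p : I -> Ainf) (g h : I) :
  (forall i, is_projection (p i)) -> \sum_i p i = 1 -> g != h ->
  p h * p g = 0.
Proof.
move=> pP p1 gh; have [pp sp] := pP g.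
have pcompl i : inf_bound 1 (p g - p g * p i * p g).
  have -> : p g - p g * p i * p g = p g * (1 - p i) * p g.
    by rewrite mulrBr mulr1 mulrBl pp.
  apply: inf_boundM; last exact: inf_bound_proj.
  apply: inf_boundM; first exact: inf_bound_proj.
  apply: inf_bound_proj; have [qq sq] := pP i; split.
    by rewrite mulrBr mulr1 mulrBl mul1r qq subrr subr0.
  by rewrite starD starN star1 sq.
pose x := p g * p h * p g.
pose m := #|[pred i | i != h]|.
have [m' mE] : exists m', m = m'.+1.
  by exists m.-1; rewrite prednK//; apply/card_gt0P; exists g.
(* The compressions of [1 - p i] with [i != h] add up to [(m - 1) p_g + x]. The one for [i = g] is
   zero and gives way to [p g], so [p g *+ m + x] is a sum of [m] contractions. *)
have sumE : \sum_(i | i != h) (if i == g then p g else p g - p g * p i * p g) =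
    p g *+ m + x.
  transitivity (\sum_(i | i != h) (p g - p g * p i * p g) +
      \sum_(i | i != h) (if i == g then p g else 0)).
    rewrite -big_split /=; apply: eq_bigr => i _; case: eqP => [->|];
      last by rewrite addr0.
    by rewrite !pp subrr add0r.
  rewrite -[X in _ + X]big_mkcondr /= [X in _ + X](big_pred1 g) => [|i];
    last first.
    by rewrite /=; have [->|_] := eqVneq i g; rewrite ?gh ?andbF.
  rewrite sumrB sumr_const -/m -mulr_suml -mulr_sumr.
  have -> : \sum_(i | i != h) p i = 1 - p h.
    by rewrite -p1 [in RHS](bigD1 h) //= addrC addrK.
  by rewrite mulrBr mulr1 mulrBl pp opprB !addrA subrK.
have gap0 : selfadjoint_gap (p g) ((m%:R^-1 : R)%:C%C *: x).
  have rc (a : R) : (a%:C%C)^* = a%:C%C.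
    by apply/eqP; rewrite eq_complex /= oppr0 !eqxx.
  split.
  - by rewrite starZ rc !starM sp (pP h).2 mulrA.
  - by rewrite -scalerAr !mulrA pp.
  - by rewrite -scalerAl -mulrA pp.
  - have -> : p g + (m%:R^-1 : R)%:C%C *: x =
    (m%:R^-1 : R)%:C%C *: (p g *+ m + x).
      by rewrite scalerDr mE scaleVMn.
    apply: (@inf_boundZr _ m%:R); first by rewrite invr_ge0.
      by rewrite mulVf// mE pnatr_eq0.
    rewrite -sumE; apply: inf_bound_sum => i _; case: eqP => // _.
    exact: inf_bound_proj.
  - have -> : p g - (m%:R^-1 : R)%:C%C *: x =
        (m%:R^-1 : R)%:C%C *: (p g *+ m' + (p g - x)).
      by rewrite addrA -mulrSr -mE scalerBr mE scaleVMn.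
    apply: (@inf_boundZr _ (1 *+ m' + 1)); first by rewrite invr_ge0.
      by rewrite -mulrSr -mE mulVf// mE pnatr_eq0.
    apply: inf_boundD; last exact: pcompl.
    by apply: inf_boundMn; exact: inf_bound_proj.
have x0 : x = 0.
  have := gap_eq0 (pP g) gap0 => /eqP; rewrite scaler_eq0 => /orP[|/eqP//].
  by rewrite fmorph_eq0 invr_eq0 mE pnatr_eq0.
(* [x] is [star (p h * p g) * (p h * p g)], so its vanishing forces that of [p h * p g]. *)
apply: inf_bound_eq0 => c c0; apply: inf_bound_star; first exact: ltW.
rewrite starM sp (pP h).2 mulrA -(mulrA (p g)) (pP h).1 -/x x0.
by apply: inf_bound0; rewrite exprn_ge0// ltW.
Qed.

End ExtremePoint.

(** * Projections obtained from a Rokhlin partition *)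

Section RokhlinSequences.
Variables (gT : finGroupType) (R : realType) (A : cstarType R).
Variable alpha : cstar_action gT A.
Local Notation Ainf := (Ainfty A).
Local Notation B := (crossed_product alpha).
Local Notation F := (fixed_algebra alpha).

Variable s : gT -> linfty A.
Local Notation e g := (cls (s g)).
Hypothesis e_central : forall g, central_sequences (e g).
Hypothesis e_proj : forall g, is_projection (e g).
Hypothesis e_sum : \sum_g e g = 1.
Hypothesis e_aut : forall g h, aut_infty alpha g (e h) = e (g * h)%g.

Let e_orth g h : e g * e h = if g == h then e g else 0.
Proof.
have [->|gh] := eqVneq g h; first exact: (e_proj h).1.
by apply: (partition_orthogonal e_proj e_sum); rewrite eq_sym.
Qed.

Lemma cls0 : cls (0 : linfty A) = 0.
Proof. by apply: (addrI (cls 0)); rewrite -clsD !addr0. Qed.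

Lemma cls_sum (I : Type) (r : seq I) (f : I -> linfty A) :
  cls (\sum_(i <- r) f i) = \sum_(i <- r) cls (f i).
Proof. exact: (big_morph _ (@clsD R A) cls0). Qed.

Lemma linfty_sum (I : Type) (r : seq I) (f : I -> linfty A) n :
  (\sum_(i <- r) f i) n = \sum_(i <- r) f i n.
Proof. exact: (big_morph (fun x : linfty A => x n)). Qed.

Lemma aut_seqM g (x y : linfty A) :
  aut_seq alpha g (x * y) = aut_seq alpha g x * aut_seq alpha g y.
Proof. by apply/val_inj/funext => n; rewrite /= rmorphM. Qed.

Lemma aut_seq_cst g a : aut_seq alpha g (cst_seq a) = cst_seq (alpha g a).
Proof. exact/val_inj. Qed.

Let cls_aut_s g h : cls (aut_seq alpha g (s h)) = e (g * h)%g.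
Proof. by rewrite -aut_infty_cls e_aut. Qed.

Lemma cst_clsM (a b : A) : cst_cls (a * b) = cst_cls a * cst_cls b.
Proof. by rewrite /cst_cls -clsM; congr cls; exact/val_inj. Qed.

Lemma cst_cls_star (a : A) : star (cst_cls a) = cst_cls (star a).
Proof. by rewrite /cst_cls cls_star; congr cls; exact/val_inj. Qed.

Lemma linfty_bounded (x : linfty A) :
  exists2 M, 0 <= M & forall n, cnorm (x n) <= M.
Proof.
case: x => x /[dup] /boundedP[M xM] xb; exists M => //.
exact: le_trans (cnorm_ge0 _) (xM 0%N).
Qed.

(** The element [a u_k] of the crossed product. *)
Definition single (k : gT) (a : A) : B := [ffun g => if g == k then a else 0].

Lemma singleB k : {morph single k : a b / a - b}.
Proof. by move=> a b; apply/ffunP => g; rewrite !ffunE; case: eqP;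
  rewrite ?subr0. Qed.

Lemma singleD k : {morph single k : a b / a + b}.
Proof. by move=> a b; apply/ffunP => g; rewrite !ffunE; case: eqP;
  rewrite ?addr0. Qed.

Lemma single0 k : single k 0 = 0.
Proof. by apply/ffunP => g; rewrite !ffunE; case: eqP. Qed.

Lemma singleZ k c a : single k (c *: a) = c *: single k a.
Proof. by apply/ffunP => g; rewrite !ffunE; case: eqP; rewrite ?scaler0. Qed.

Lemma singleM k l a b : single k a * single l b =
  single (k * l)%g (a * alpha k b).
Proof.
apply/ffunP => g; rewrite !ffunE (bigD1 k) //= big1 ?addr0 => [|i /negPf ik].
  rewrite !ffunE eqxx (can2_eq (mulKVg k) (mulKg k)).
  by case: eqP; rewrite ?rmorph0 ?mulr0.
by rewrite ffunE ik mul0r.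
Qed.

Lemma single_star k a : star (single k a) =
  single k^-1%g (alpha k^-1%g (star a)).
Proof.
apply/ffunP => g; rewrite !ffunE (can2_eq invgK invgK).
by case: eqP => [->|_]; rewrite ?star0 ?rmorph0.
Qed.

Lemma single_decomp (f : B) : f = \sum_k single k (f k).
Proof.
apply/ffunP => g; rewrite sum_ffunE (bigD1 g) //= big1 => [|i ig].
  by rewrite ffunE eqxx addr0.
by rewrite ffunE eq_sym (negPf ig).
Qed.

Lemma l1norm_single k a : l1norm (single k a) = cnorm a.
Proof.
rewrite /l1norm (bigD1 k) //= big1 => [|i /negPf ik].
  by rewrite ffunE eqxx addr0.
by rewrite ffunE ik cnorm0.
Qed.

(** * Asymptotic matrix units in the crossed product *)

Let l1P := l1norm_banach alpha.
Local Notation null := (null_seq (@l1norm gT R A alpha)).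
Local Notation span := (asymptotic_span (@l1norm gT R A alpha)).

Lemma null_single k (x y : linfty A) (f : nat -> B) : cls x = cls y ->
  (forall n, f n = single k (x n - y n)) -> null f.
Proof.
move=> xy fE d d0; apply: filterS (cls_near xy d0) => n.
by rewrite fE l1norm_single.
Qed.

(* These behave asymptotically as E_gh (x) a in M_G (x) A. *)
Definition unit_seq g h a n : B := single (g * h^-1)%g (s g n * alpha g a).

(** Moving [u_(g h^-1)] to the right turns [e_k] into [e_(g h^-1 k)]. Centrality brings it next to
    [e_g], and orthogonality leaves only the case [g = g h^-1 k], that is [h = k]. *)
Lemma unit_seqM g h a k l b : null (fun n =>
  unit_seq g h a n * unit_seq k l b n -
  if h == k then unit_seq g l (a * b) n else 0).
Proof.
pose x := s g * cst_seq (alpha g a) *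
  aut_seq alpha (g * h^-1)%g (s k * cst_seq (alpha k b)).
have xE : cls x = if h == k then cls (s g * cst_seq (alpha g (a * b))) else 0.
  rewrite /x aut_seqM aut_seq_cst !clsM cls_aut_s -/(cst_cls _) -/(cst_cls _).
  rewrite -autM -mulrA [cst_cls _ * _]mulrA -e_central -!mulrA [LHS]mulrA
    e_orth.
  have -> : (g == g * h^-1 * k)%g = (h == k).
    by rewrite -mulgA eq_sym -{2}(mulg1 g) (inj_eq (mulgI g)) -eq_mulVg1.
  have [->|hk] := eqVneq h k; last by rewrite mul0r.
  by rewrite mulgKV rmorphM -/(cst_cls _) cst_clsM.
rewrite /unit_seq; have [hk|hk] := eqVneq h k.
  subst k; move: xE; rewrite eqxx => /(null_single (k := (g * l^-1)%g));
    apply=> n.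
  by rewrite singleM mulgA mulgKV -singleB.
move: xE; rewrite (negPf hk) -cls0.
move=> /(null_single (k := (g * h^-1 * (k * l^-1))%g)); apply=> n.
by rewrite singleM !subr0.
Qed.

(** The automorphism of [h g^-1] carries [e_g] to [e_h] and [alpha_g] to [alpha_h]; centrality
    restores the order that the adjoint reverses. *)
Lemma unit_seq_star g h a : null (fun n =>
  star (unit_seq g h a n) - unit_seq h g (star a) n).
Proof.
pose x := aut_seq alpha (h * g^-1)%g (star (s g * cst_seq (alpha g a))).
have xE : cls x = cls (s h * cst_seq (alpha h (star a))).
  have aut_star_seq (y : linfty A) k :
      aut_seq alpha k (star y) = star (aut_seq alpha k y).
    by apply/val_inj/funext => n; exact: aut_star.
  rewrite /x aut_star_seq aut_seqM aut_seq_cst -cls_star !clsM cls_aut_s mulgKV.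
  by rewrite -autM mulgKV starM (e_proj h).2 -/(cst_cls _) cst_cls_star
    -aut_star e_central.
apply: (null_single (k := (h * g^-1)%g) xE) => n.
by rewrite single_star invMg invgK -singleB.
Qed.

Lemma unit_seqB g h a b n :
  unit_seq g h (a - b) n = unit_seq g h a n - unit_seq g h b n.
Proof. by rewrite /unit_seq rmorphB mulrBr singleB. Qed.

Lemma unit_seq_lin (I : Type) (r : seq I) g h (c : I -> R[i]) (a : I -> A) n :
  unit_seq g h (\sum_(i <- r) c i *: a i) n =
  \sum_(i <- r) c i *: unit_seq g h (a i) n.
Proof.
elim: r => [|i r IH].
  by rewrite !big_nil /unit_seq rmorph0 mulr0 single0.
by rewrite !big_cons -IH /unit_seq linearP mulrDr singleD -scalerAr singleZ.
Qed.

Lemma unit_seq_le g h : exists2 M, 0 <= M &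
  forall a n, l1norm (unit_seq g h a n) <= M * cnorm a.
Proof.
have [M M0 sM] := linfty_bounded (s g); exists M => // a n.
rewrite l1norm_single (le_trans (cnormM _ _))// cnorm_aut.
by rewrite ler_wpM2r ?cnorm_ge0.
Qed.

(* The element m (x) a of M_G (x) A. *)
Definition matrix_seq (m : gT -> gT -> R[i]) (a : A) n : B :=
  \sum_i \sum_j m i j *: unit_seq i j a n.

Lemma matrix_seq_bounded m a :
  bounded_seq_for (@l1norm _ _ _ alpha) (matrix_seq m a).
Proof.
apply: (bounded_seq_sum l1P) => i; apply: (bounded_seq_sum l1P) => j.
apply: (bounded_seqZ l1P); have [M M0 MP] := unit_seq_le i j.
by exists (M * cnorm a) => n.
Qed.

Lemma matrix_seq_mul m q : (forall i k, \sum_j m i j * m j k = m i k) ->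
  q * q = q ->
  null (fun n => matrix_seq m q n * matrix_seq m q n - matrix_seq m q n).
Proof.
move=> mm qq.
(* Idempotency of [m] contracts the sum over the middle index, so only the errors in the matrix unit
   relations remain. *)
have E n : matrix_seq m q n * matrix_seq m q n - matrix_seq m q n =
    \sum_i \sum_j \sum_k \sum_l (m i j * m k l) *:
      (unit_seq i j q n * unit_seq k l q n -
       if j == k then unit_seq i l (q * q) n else 0).
  rewrite {1 2}/matrix_seq mulr_suml -sumrB; apply: eq_bigr => i _.
  transitivity (\sum_j (\sum_k \sum_l (m i j * m k l) *:
        (unit_seq i j q n * unit_seq k l q n) -
      \sum_l (m i j * m j l) *: unit_seq i l q n)).
    rewrite mulr_suml sumrB; congr (_ - _).
      apply: eq_bigr => j _; rewrite mulr_sumr; apply: eq_bigr => k _.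
      rewrite mulr_sumr; apply: eq_bigr => l _.
      by rewrite -scalerAl -scalerAr scalerA.
    rewrite exchange_big; apply: eq_bigr => l _.
    by rewrite -scaler_suml mm.
  apply: eq_bigr => j _.
  have -> : \sum_l (m i j * m j l) *: unit_seq i l q n =
      \sum_k \sum_l (m i j * m k l) *: (if j == k then unit_seq i l (q * q) n
        else 0).
    rewrite [RHS](bigD1 j) //= [X in _ + X]big1 => [|k /negPf kj].
      by rewrite addr0 eqxx qq.
    by apply: big1 => l _; rewrite eq_sym kj scaler0.
  rewrite -sumrB; apply: eq_bigr => k _; rewrite -sumrB; apply: eq_bigr => l _.
  by rewrite scalerBr.
under [X in null X]funext => n do rewrite (E n).
do 4 (apply: (null_seq_sum l1P) => ?).
by apply: (null_seqZ l1P); exact: unit_seqM.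
Qed.

Lemma matrix_seq_span (m : gT -> gT -> R[i]) q :
  (forall i k, \sum_j m i j * m j k = m i k) ->
    (forall i j, (m j i)^* = m i j) ->
  is_projection q -> span (matrix_seq m q).
Proof.
move=> mm ms [qq sq]; apply: (asymptotic_span_projections l1P).
- exact: matrix_seq_bounded.
- exact: matrix_seq_mul.
- have E n : star (matrix_seq m q n) - matrix_seq m q n =
      \sum_i \sum_j m i j *: (star (unit_seq j i q n) - unit_seq i j (star q)
        n).
    rewrite sq star_sum; under eq_bigr do rewrite star_sum.
    rewrite exchange_big /= -sumrB; apply: eq_bigr => i _.
    rewrite -sumrB; apply: eq_bigr => j _.
    by rewrite starZ ms scalerBr.
  under [X in null X]funext => n do rewrite (E n).
  do 2 (apply: (null_seq_sum l1P) => ?).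
  by apply: (null_seqZ l1P); exact: unit_seq_star.
Qed.

(* E_gh = 1/4 sum_k i^k v_k v_k^* with v_k = delta_g + i^k delta_h, and each
   v_k v_k^* is a multiple of a projection as soon as g != h. *)
Lemma matrix_unit_span g h q : is_projection q ->
  span (matrix_seq (fun i j => ((i == g) && (j == h))%:R) q).
Proof.
move=> qP.
pose d (k i : gT) : R[i] := (i == k)%:R.
have dc k i : (d k i)^* = d k i by rewrite /d conjC_nat.
have dd k i : d k i * d k i = d k i by rewrite /d; case: eqP;
  rewrite ?mulr1 ?mulr0.
have d1 k : \sum_i d k i = 1.
  by rewrite (bigD1 k) //= big1 => [|i /negPf ik]; rewrite /d ?eqxx ?addr0// ik.
(* [c v v^*] is a projection matrix once [c] is the inverse of the squared length of [v]. *)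
have rank1 (c : R[i]) (v : gT -> R[i]) : c^* = c ->
    c * (\sum_j v j * (v j)^*) = 1 ->
      span (matrix_seq (fun i j => c * v i * (v j)^*) q).
  move=> cc cv; apply: matrix_seq_span => // [i k|i j].
    transitivity (c * v i * (v k)^* * (c * \sum_j v j * (v j)^*));
      last by rewrite cv mulr1.
    rewrite !mulr_sumr; apply: eq_bigr => j _; ring.
  by rewrite !rmorphM /= conjCK cc; ring.
have [<-|gh] := eqVneq g h.
  have := rank1 1 (d g); rewrite mul1r rmorph1.
  under [X in X = 1 -> _]eq_bigr => j do rewrite dc dd.
  move=> /(_ erefl (d1 g)).
  congr (span (matrix_seq _ q)); apply/funext => i; apply/funext => j.
  by rewrite mul1r dc /d -natrM mulnb.
pose I : R[i] := 'i%C.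
have II : I * I = -1 by rewrite -expr2 sqr_i.
have Ic : I^* = - I by apply/eqP; rewrite eq_complex /= oppr0 !eqxx.
pose v z i := d g i + z * d h i.
(* The cross terms vanish for [g != h], so [v z] has squared length 2 when [z] has modulus 1; hence
   the factor [2^-1]. *)
have Pv z : z * z^* = 1 -> span (matrix_seq (fun i j =>
  2^-1 * v z i * (v z j)^*) q).
  move=> z1; apply: rank1; first by rewrite fmorphV /= conjC_nat.
  have -> : \sum_j v z j * (v z j)^* = \sum_j (d g j + d h j).
    apply: eq_bigr => j _; rewrite /v rmorphD rmorphM /= !dc.
    have gh0 : d g j * d h j = 0.
      by rewrite /d; case: eqP => [->|]; rewrite ?mul0r// (negPf gh) mulr0.
    transitivity (d g j * d g j + (z * z^*) * (d h j * d h j) +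
      (z + z^*) * (d g j * d h j)); first ring.
    by rewrite gh0 z1 !dd mulr0 addr0 mul1r.
  by rewrite big_split /= !d1 -mulr2n mulVf// pnatr_eq0.
pose T z n := matrix_seq (fun i j => 2^-1 * v z i * (v z j)^*) q n.
(* Polarization over the fourth roots of unity: the [z z^*] sum to 4 and keep [E_gh], while the [z]
   and [z^2] sum to 0. Half of the factor [1/4] already sits in [T]. *)
have -> : matrix_seq (fun i j => ((i == g) && (j == h))%:R) q = fun n =>
    2^-1 *: (T 1 n + I *: T I n + (-1) *: T (-1) n + (- I) *: T (- I) n).
  apply/funext => n; rewrite /T /matrix_seq !scaler_sumr -!big_split /=
    scaler_sumr; apply: eq_bigr => i _.
  rewrite !scaler_sumr -!big_split /= scaler_sumr; apply: eq_bigr => j _.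
  rewrite !scalerA -!scalerDl scalerA; congr (_ *: _).
  have vc z : (v z j)^* = d g j + z^* * d h j.
    by rewrite /v rmorphD rmorphM /= !dc.
  rewrite !vc !rmorphN rmorph1 /= Ic /v.
  transitivity (4^-1 * ((2 - 2 * (I * I)) * (d g i * d h j) +
    (2 + 2 * (I * I)) * (d h i * d g j))); last by field.
  by rewrite II -mulnb natrM -/(d g i) -/(d h j); field.
apply: (asymptotic_spanZ l1P); do ?[apply: (asymptotic_spanD l1P)];
  do ?[apply: (asymptotic_spanZ l1P)]; apply: Pv.
- by rewrite rmorph1 mulr1.
- by rewrite Ic mulrN II opprK.
- by rewrite rmorphN rmorph1 mulrNN mulr1.
- by rewrite rmorphN /= Ic opprK mulNr II opprK.
Qed.

(** [unit_seq g h] is linear in [a] with a bound uniform in [n], so the LP property of [A] reduces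
    the claim to projections. *)
Lemma unit_seq_span g h a : LP_property A -> span (unit_seq g h a).
Proof.
move=> ALP; apply: (asymptotic_span_approx l1P) => d d0.
have [M M0 MP] := unit_seq_le g h.
have M1 : 0 < M + 1 by rewrite ltr_wpDl.
have [_ [r [c [p [pP ->]]]] ax] := ALP a _ (divr_gt0 d0 M1).
exists (unit_seq g h (\sum_i c i *: p i)); last first.
  apply: nearW => n; rewrite -unit_seqB (le_lt_trans (MP _ _))//.
  move: ax; rewrite ltr_pdivlMr//; apply: le_lt_trans.
  by rewrite mulrC ler_wpM2l ?cnorm_ge0// lerDl.
under [X in span X]funext => n do rewrite unit_seq_lin.
apply: (asymptotic_span_sum l1P) => i; apply: (asymptotic_spanZ l1P).
have := matrix_unit_span g h (pP i).
congr (span _); apply/funext => n; rewrite /matrix_seq (bigD1 g) //=.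
rewrite [X in _ + X]big1 => [|k /negPf kg].
  rewrite addr0 (bigD1 h) //= big1 => [|l /negPf lh].
    by rewrite !eqxx addr0 scale1r.
  by rewrite lh andbF scale0r.
by apply: big1 => l _; rewrite kg scale0r.
Qed.

(** By the partition of unity, [f(k) u_k] is asymptotically [sum_g e_g f(k) u_k], whose [g]-th term
    represents [E_(g, k^-1 g)] tensor [alpha_(g^-1)(f(k))]. *)
Lemma Rokhlin_crossed_LP : LP_property A -> LP_property B.
Proof.
move=> ALP; apply: (LP_of_asymptotic_span (@crossed_cnorm_le_l1 _ _ _ alpha))
  => f.
rewrite (single_decomp f); apply: (asymptotic_span_sum l1P) => k.
apply: (asymptotic_span_eq l1P (t := fun n =>
  \sum_g unit_seq g (k^-1 * g)%g (alpha g^-1%g (f k)) n)).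
  by apply: (asymptotic_span_sum l1P) => g; exact: unit_seq_span.
pose x := (\sum_g s g) * cst_seq (f k).
have xE : cls (cst_seq (f k)) = cls x by rewrite /x clsM cls_sum e_sum mul1r.
apply: (null_single (k := k) xE) => n; rewrite singleB; congr (_ - _).
rewrite linftyM linfty_sum mulr_suml.
rewrite (big_morph (single k) (@singleD k) (single0 k)); apply: eq_bigr => g _.
by rewrite /unit_seq invMg invgK mulKVg autVK.
Qed.

(** * The fixed point algebra *)

Let card_gT : exists m, #|gT| = m.+1.
Proof. by exists #|gT|.-1; rewrite prednK//; apply/card_gt0P; exists 1%g. Qed.

Lemma mean_fixed (x : A) :
  (#|gT|%:R^-1 : R)%:C%C *: \sum_h alpha h x \in fixed_pred alpha.
Proof.
apply/fixedP => g; rewrite linearZ rmorph_sum /=; congr (_ *: _).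
rewrite [RHS](reindex_inj (mulgI g)) /=; apply: eq_bigr => h _.
by rewrite autM.
Qed.

(** The conditional expectation onto the fixed points. It turns asymptotically fixed sequences into
    sequences in the fixed point algebra itself. *)
Definition mean (x : A) : F := FixedAlgebra (mean_fixed x).

Lemma meanB : {morph mean : x y / x - y}.
Proof.
move=> x y; apply: val_inj => /=; rewrite -scalerBr -sumrB; congr (_ *: _).
by apply: eq_bigr => g _; rewrite rmorphB.
Qed.

Lemma meanD : {morph mean : x y / x + y}.
Proof.
move=> x y; apply: val_inj => /=; rewrite -scalerDr -big_split /=;
  congr (_ *: _).
by apply: eq_bigr => g _; rewrite rmorphD.
Qed.

Lemma meanZ c x : mean (c *: x) = c *: mean x.
Proof.
apply: val_inj => /=; rewrite scalerA mulrC -scalerA; congr (_ *: _);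
  rewrite scaler_sumr.
by apply: eq_bigr => g _; rewrite linearZ.
Qed.

Lemma mean_le x : cnorm (mean x) <= cnorm x.
Proof.
rewrite [leLHS]cnormZ normc_ge0_real ?invr_ge0//.
have [m mE] := card_gT.
rewrite ler_pdivrMl ?mE ?ltr0Sn// (le_trans (cnorm_sum _ _ _))//.
under eq_bigr do rewrite cnorm_aut.
by rewrite sumr_const mE mulr_natl.
Qed.

Definition mean_linfty (x : linfty A) : linfty A :=
  (#|gT|%:R^-1 : R)%:C%C *: \sum_h aut_seq alpha h x.

Lemma mean_linftyE x n : mean_linfty x n = val (mean (x n)).
Proof.
transitivity ((#|gT|%:R^-1 : R)%:C%C *: (\sum_h aut_seq alpha h x) n) => //.
by rewrite linfty_sum.
Qed.

(* The homomorphism A -> A^oo, a |-> sum_g e_g alpha_g(a); it takes values in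
   the fixed points and is the identity on the fixed points of A. *)
Definition equivariant_seq a : linfty A := \sum_g s g * cst_seq (alpha g a).

Lemma equivariant_seqE a n : equivariant_seq a n = \sum_g s g n * alpha g a.
Proof. exact: linfty_sum. Qed.

Lemma equivariant_seqB a b n :
  equivariant_seq (a - b) n = equivariant_seq a n - equivariant_seq b n.
Proof.
rewrite !equivariant_seqE -sumrB; apply: eq_bigr => g _.
by rewrite rmorphB mulrBr.
Qed.

Lemma equivariant_seq_lin (I : Type) (r : seq I) (c : I -> R[i])
    (a : I -> A) n :
  equivariant_seq (\sum_(i <- r) c i *: a i) n =
  \sum_(i <- r) c i *: equivariant_seq (a i) n.
Proof.
rewrite equivariant_seqE; under [RHS]eq_bigr do rewrite equivariant_seqE
  scaler_sumr.
rewrite [RHS]exchange_big /=; apply: eq_bigr => g _.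
rewrite linear_sum mulr_sumr; apply: eq_bigr => i _.
by rewrite linearZ scalerAr.
Qed.

Lemma equivariant_seq_le : exists2 M, 0 <= M &
  forall a n, cnorm (equivariant_seq a n) <= M * cnorm a.
Proof.
have sM g : exists M, 0 <= M /\ forall n, cnorm (s g n) <= M.
  by have [M] := linfty_bounded (s g); exists M.
have [M MP] := choice sM; exists (\sum_g M g).
  by apply: sumr_ge0 => g _; have [] := MP g.
move=> a n; rewrite equivariant_seqE (le_trans (cnorm_sum _ _ _))// mulr_suml.
apply: ler_sum => g _; rewrite (le_trans (cnormM _ _))// cnorm_aut.
by rewrite ler_wpM2r ?cnorm_ge0//; have [_] := MP g.
Qed.

Lemma cls_equivariant a :
  cls (equivariant_seq a) = \sum_g e g * cst_cls (alpha g a).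
Proof. by rewrite cls_sum; apply: eq_bigr => g _; rewrite clsM. Qed.

Lemma cls_equivariantM a b : cls (equivariant_seq a) * cls (equivariant_seq b) =
  cls (equivariant_seq (a * b)).
Proof.
rewrite !cls_equivariant mulr_suml; apply: eq_bigr => g _.
rewrite mulr_sumr (bigD1 g) //= big1 => [|h hg].
  rewrite addr0 mulrA -[X in X * _]mulrA -e_central mulrA e_orth eqxx.
  by rewrite -mulrA -cst_clsM -rmorphM.
by rewrite mulrA -[X in X * _]mulrA -e_central mulrA e_orth eq_sym (negPf hg)
  !mul0r.
Qed.

Lemma cls_equivariant_star a :
  star (cls (equivariant_seq a)) = cls (equivariant_seq (star a)).
Proof.
rewrite !cls_equivariant star_sum; apply: eq_bigr => g _.
by rewrite starM (e_proj g).2 cst_cls_star -aut_star e_central.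
Qed.

(** [alpha_h] sends the class [e_g alpha_g(a)] to [e_(hg) alpha_(hg)(a)], so it permutes the
    summands and all terms of the average have the same class. *)
Lemma cls_mean_equivariant a :
  cls (mean_linfty (equivariant_seq a)) = cls (equivariant_seq a).
Proof.
rewrite /mean_linfty clsZ cls_sum.
rewrite (eq_bigr (fun=> cls (equivariant_seq a))) => [|h _].
  have [m mE] := card_gT.
  by rewrite sumr_const mE scaleVMn.
have -> : aut_seq alpha h (equivariant_seq a) =
    \sum_g aut_seq alpha h (s g) * cst_seq (alpha (h * g)%g a).
  apply/val_inj/funext => n; rewrite [RHS]linfty_sum [LHS]/= linfty_sum
    rmorph_sum.
  by apply: eq_bigr => g _; rewrite !linftyM rmorphM /= autM.
rewrite cls_sum cls_equivariant [RHS](reindex_inj (mulgI h)) /=.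
by apply: eq_bigr => g _; rewrite clsM cls_aut_s.
Qed.

Let FP := cstar_banach F.
Local Notation nullF := (null_seq (@cnorm R F)).
Local Notation spanF := (asymptotic_span (@cnorm R F)).

Lemma null_fixed (x y : linfty A) (f : nat -> F) : cls x = cls y ->
  (forall n, val (f n) = x n - y n) -> nullF f.
Proof.
move=> xy fE d d0; apply: filterS (cls_near xy d0) => n.
by rewrite -fE.
Qed.

(** [mean] is not multiplicative in general, but it leaves the class of [equivariant_seq q]
    unchanged, and that class is a projection. *)
Lemma mean_equivariant_span q : is_projection q ->
  spanF (fun n => mean (equivariant_seq q n)).
Proof.
move=> [qq sq]; set x := equivariant_seq q.
apply: (asymptotic_span_projections FP).
- have [M _ xM] := linfty_bounded x; exists M => n.
  exact: le_trans (mean_le _) (xM n).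
- apply: (@null_fixed (mean_linfty x * mean_linfty x) (mean_linfty x)) => [|n].
    by rewrite clsM !cls_mean_equivariant cls_equivariantM qq.
  by rewrite linftyM !mean_linftyE.
- apply: (@null_fixed (star (mean_linfty x)) (mean_linfty x)) => [|n].
    by rewrite -cls_star !cls_mean_equivariant cls_equivariant_star sq.
  transitivity (star (mean_linfty x n) - mean_linfty x n) => //.
  by rewrite !mean_linftyE.
Qed.

(** For fixed [f] the sequence [mean (x n)] is asymptotically [f]. Approximating [f] in [A] by
    combinations of projections and applying the uniformly bounded linear maps
    [a |-> mean (equivariant_seq a n)] reduces the claim to projections. *)
Lemma Rokhlin_fixed_LP : LP_property A -> LP_property F.
Proof.
move=> ALP; apply: (LP_of_asymptotic_span (fun x => lexx (cnorm x))) => f.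
pose x := equivariant_seq (val f).
have fE g : alpha g (val f) = val f by case: (f) => y /= /fixedP.
have fx : cls (cst_seq (val f)) = cls (mean_linfty x).
  rewrite cls_mean_equivariant cls_equivariant.
  by under eq_bigr do rewrite fE; rewrite -mulr_suml e_sum mul1r.
apply: (asymptotic_span_eq FP (t := fun n => mean (x n))); last first.
  by apply: (null_fixed fx) => n; rewrite mean_linftyE.
apply: (asymptotic_span_approx FP) => d d0.
have [M M0 MP] := equivariant_seq_le.
have M1 : 0 < M + 1 by rewrite ltr_wpDl.
have [_ [r [c [p [pP ->]]]] ax] := ALP (val f) _ (divr_gt0 d0 M1).
exists (fun n => mean (equivariant_seq (\sum_i c i *: p i) n)); last first.
  apply: nearW => n; rewrite -meanB -equivariant_seqB.
  rewrite (le_lt_trans (mean_le _))//.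
  rewrite (le_lt_trans (MP _ _))//.
  move: ax; rewrite ltr_pdivlMr//; apply: le_lt_trans.
  by rewrite mulrC ler_wpM2l ?cnorm_ge0// lerDl.
have mean0 : mean 0 = 0 by rewrite -(subrr 0) meanB subrr.
rewrite (_ : (fun n => _) = fun n =>
  \sum_i c i *: mean (equivariant_seq (p i) n)).
  apply: (asymptotic_span_sum FP) => i; apply: (asymptotic_spanZ FP).
  exact: mean_equivariant_span.
apply/funext => n; rewrite equivariant_seq_lin (big_morph mean meanD mean0).
by apply: eq_bigr => i _; rewrite meanZ.
Qed.

End RokhlinSequences.

Theorem theorem3p2 (R : realType) (A : cstarType R) (gT : finGroupType)
    (alpha : cstar_action gT A) (A_simple : simple_cstar A)
    (alpha_Rokhlin : Rokhlin_property alpha) (A_LP : LP_property A) :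
  LP_property (fixed_algebra alpha) /\ LP_property (crossed_product alpha).
Proof.
have [e [e_central e_proj e_sum e_aut]] := alpha_Rokhlin.
have [s sE] := choice (fun g => clsP (e g)).
have {sE} eE : e = fun g => cls (s g) by apply/funext.
subst e; split.
- exact: Rokhlin_fixed_LP e_central e_proj e_sum e_aut A_LP.
- exact: Rokhlin_crossed_LP e_central e_proj e_sum e_aut A_LP.
Qed.
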